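(* Let $p$ be a prime number. Suppose that $G$ is a pro-$p$ Polish abelian group. The following assertions are equivalent: (1) $G$ is injective in $\mathbf{PAb}(p)$; (2) $G$ is divisible and it has a basis of zero neighborhoods consisting of divisible subgroups; (3) $G\cong \mathbb{Z}( p^{\infty }) ^{\alpha }\oplus (\mathbb{Z}( p^{\infty }) ^{( \omega ) })^{\beta }$ for some $\alpha ,\beta \leq \omega $; (4) $\mathrm{Ext}((\mathbb{Z}( p^{\infty }) ^{( \omega ) })^{\omega },G)=0$.
   Context: A Polish abelian group is an abelian topological group whose topology is Polish. An abelian Polish Lie group is a Polish abelian group isomorphic to $\mathbb{R}^{n}\oplus \mathbb{T}^{d}\oplus D$ with $n,d\in\omega$ and $D$ countable discrete. For a Polish abelian group $G$, $\mathcal{N}(G)$ is the set of closed subgroups $N$ with $G/N$ a Lie group, ordered by reverse inclusion. $G$ is pro-Lie if every neighborhood of $0$ contains an element of $\mathcal{N}(G)$. A locally compact Polish abelian group $A$ is a topological $p$-group if $p^{n}x\to 0$ for every $x\in A$ (equivalently, $A$ has a basis of zero neighborhoods consisting of open subgroups $U$ such that $A/U$ is a $p$-group). A pro-$p$ Polish abelian group is a pro-Lie Polish abelian group $G$ such that every element of $\mathcal{N}(G)$ contains some $N\in\mathcal{N}(G)$ for which $G/N$ is a topological $p$-group. $\mathbf{PAb}(p)$ is the category of pro-$p$ Polish abelian groups and continuous homomorphisms; it is a thick subcategory of the category of pro-Lie Polish abelian groups. Short exact sequences are the sequences $0\to A\to B\to C\to 0$ of continuous homomorphisms that are algebraically exact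 with $A\to B$ a homeomorphism onto a closed subgroup. An object $I$ is injective if $\mathrm{Hom}(-,I)$ maps short exact sequences to short exact sequences of abelian groups. $\mathrm{Ext}(A,B)$ is the group of isomorphism classes of extensions $0\to B\to X\to A\to 0$ (of Polish abelian groups), so $\mathrm{Ext}(A,B)=0$ means every such short exact sequence splits. $\mathbb{Z}(p^{\infty})$ is the Prüfer $p$-group and $\mathbb{Z}(p^{\infty})^{(\omega)}$ the direct sum of countably many copies, both with the discrete topology; powers with exponent $\leq\omega$ carry the product topology. *)

(* Defs.v *)
From HB Require Import structures.
From mathcomp Require Import all_boot all_order all_algebra.
From mathcomp Require Import all_classical all_reals all_analysis.
Import Order.TTheory GRing.Theory Num.Theory.
Import numFieldNormedType.Exports.

Set Implicit Arguments.
Unset Strict Implicit.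
Unset Printing Implicit Defensive.

Local Open Scope classical_set_scope.
Local Open Scope ring_scope.

Definition tquot (G : topologicalZmodType) (N : zmodClosed G) : Type :=
  quotient_topology (Quotient.quot N).

Section TopologicalQuotient.
Context (G : topologicalZmodType) (N : zmodClosed G).
Local Open Scope quotient_scope.
Local Notation Q := (tquot N).

HB.instance Definition _ := Topological.on Q.
HB.instance Definition _ := GRing.isZmodule.Build Q (@Quotient.addqA G N)
  (@Quotient.addqC G N) (@Quotient.add0q G N) (@Quotient.addNq G N).

Let pr (x : G) : Q := \pi_(Quotient.quot N) x.

Let prB x y : pr (x - y) = pr x - pr y.
Proof. exact: raddfB. Qed.

Let prP (u : Q) : exists x, pr x = u.
Proof. by exists (repr (u : Quotient.quot N)); exact: reprK. Qed.

Let pr_cont : continuous pr.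
Proof. exact: (@pi_continuous G (Quotient.quot N)). Qed.

Let prE x y : pr x = pr y <-> x - y \in N.
Proof.
rewrite (Quotient.idealrBE N x y).
by split=> [xy|/eqP//]; apply/eqP.
Qed.

Let pr_open (U : set G) : open U -> open (pr @` U).
Proof.
move=> oU; rewrite /open/= /quotient_open.
have -> : \pi_(quotient_topology (Quotient.quot N)) @^-1` (pr @` U) =
    \bigcup_(n in [set` N]) ((fun x => x - n) @^-1` U).
  apply/seteqP; split=> x /=.
    move=> [y Uy /esym/prE xyN].
    by exists (x - y) => //=; rewrite subKr.
  move=> [n /= nN Un]; exists (x - n) => //; apply/prE.
  by rewrite addrAC subrr add0r rpredN.
apply: bigcup_open => n _.
apply: open_comp => // x _.
apply: (@continuous_comp _ _ _ (fun x => (x, n)) (fun x : G * G => x.1 - x.2)).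
  by apply: cvg_pair => /=; [exact: cvg_id|exact: cvg_cst].
exact: sub_continuous.
Qed.

Let tquot_sub_continuous : continuous (fun x : Q * Q => x.1 - x.2).
Proof.
move=> [u v] W /=; have [x <-] := prP u; have [y <-] := prP v.
rewrite -prB => /(pr_cont (x := x - y))/(@sub_continuous G (x, y)) /=.
move=> [[A B] /= [xA yB] AB].
exists (pr @` (interior A), pr @` (interior B)) => /=.
  split; apply: open_nbhs_nbhs; split; try (apply: pr_open; exact: open_interior).
  - by exists x.
  - by exists y.
move=> [_ _] [/= [a aA <-] [b bB <-]].
by rewrite -prB; apply: (AB (a, b)); split; exact: interior_subset.
Qed.

HB.instance Definition _ :=
  PreTopologicalNmodule_isTopologicalZmodule.Build Q tquot_sub_continuous.
End TopologicalQuotient.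

(* An alias: on plain products, the library's instances for [tvsType] and
   normed modules would shadow the one below. *)
Definition tdsum (A B : Type) : Type := (A * B)%type.

Section TopologicalDirectSum.
Context (A B : topologicalZmodType).

HB.instance Definition _ := Topological.copy (tdsum A B) (A * B)%type.
HB.instance Definition _ := GRing.Zmodule.copy (tdsum A B) (A * B)%type.

Let tdsum_sub_continuous :
  continuous (fun x : tdsum A B * tdsum A B => x.1 - x.2).
Proof.
move=> [[a b] [a' b']] U /= [[V W] /= [nV nW] VWU].
have [[V1 V2] /= [nV1 nV2] V12] := @sub_continuous A (a, a') _ nV.
have [[W1 W2] /= [nW1 nW2] W12] := @sub_continuous B (b, b') _ nW.
exists (V1 `*` W1, V2 `*` W2) => /=.
  by split; [exists (V1, W1)|exists (V2, W2)].
move=> [[x y] [x' y']] /= [[V1x W1y] [V2x' W2y']].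
by apply: VWU; split; [exact: (V12 (x, x'))|exact: (W12 (y, y'))].
Qed.

HB.instance Definition _ :=
  PreTopologicalNmodule_isTopologicalZmodule.Build (tdsum A B)
    tdsum_sub_continuous.
End TopologicalDirectSum.

Section TopologicalPower.
Context (I : Type) (A : topologicalZmodType).

HB.instance Definition _ := GRing.Zmodule.copy {ptws I -> A} (I -> A).

Let ptws_sub_continuous :
  continuous (fun x : {ptws I -> A} * {ptws I -> A} => x.1 - x.2).
Proof.
move=> [f g]; apply/cvg_sup => i U [_ [[W oW <-] /= Wfg WU]].
have projc (h : {ptws I -> A}) V : nbhs (h i) V -> nbhs h [set k | V (k i)].
  move=> hV; have /cvg_sup/(_ i) hi : nbhs h --> h by exact: cvg_id.
  apply: (hi [set k | V (k i)]).
  exact: (@initial_continuous _ A (fun k : {ptws I -> A} => k i) h V hV).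
have [[V1 V2] /= [fV1 gV2] V12] :=
  @sub_continuous A (f i, g i) W (open_nbhs_nbhs (conj oW Wfg)).
exists ([set k | V1 (k i)], [set k | V2 (k i)]).
  by split; exact: projc.
move=> [f' g'] /= [V1f V2g]; apply: WU.
exact: (V12 (f' i, g' i)).
Qed.

HB.instance Definition _ :=
  PreTopologicalNmodule_isTopologicalZmodule.Build {ptws I -> A}
    ptws_sub_continuous.
End TopologicalPower.

Section DiscreteGroup.
Context (D : zmodType).
HB.instance Definition _ := GRing.Zmodule.copy (discrete_topology D) D.

Let discrete_sub_continuous :
  continuous (fun x : discrete_topology D * discrete_topology D => x.1 - x.2).
Proof.
move=> [x y] W /=; rewrite nbhs_principalE => /principal_filterP Wxy.
exists ([set x], [set y]) => /=; first by split; exact: discrete_set1.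
by move=> [_ _] [/= -> ->].
Qed.

HB.instance Definition _ :=
  PreTopologicalNmodule_isTopologicalZmodule.Build (discrete_topology D)
    discrete_sub_continuous.
End DiscreteGroup.

Section Polish.
Context (R : realType).

Definition metric_on (T : Type) (d : T -> T -> R) : Prop :=
  [/\ forall x y, 0 <= d x y,
      forall x y, d x y = 0 <-> x = y,
      forall x y, d x y = d y x &
      forall x y z, d x z <= d x y + d y z].

Definition metrizes (T : topologicalType) (d : T -> T -> R) : Prop :=
  forall x : T,
    nbhs x = filter_from [set e | 0 < e] (fun e => [set y | d x y < e]).

Definition complete_metric (T : topologicalType) (d : T -> T -> R) : Prop :=
  forall u : nat -> T,
    (forall e, 0 < e ->
       exists N, forall m n, (N <= m)%N -> (N <= n)%N -> d (u m) (u n) < e) ->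
    exists x : T, u @ \oo --> x.

Definition polish (T : topologicalType) : Prop :=
  (exists2 S : set T, countable S & dense S) /\
  (exists d : T -> T -> R, [/\ metric_on d, metrizes d & complete_metric d]).
End Polish.

Definition is_chom (A B : topologicalZmodType) : {pred A -> B} :=
  fun f => `[< continuous f /\ zmod_morphism f >].
Arguments is_chom : clear implicits.

Section ContinuousHomomorphisms.
Context (A B : topologicalZmodType).

Let is_chom_zmod_closed : zmod_closed (is_chom A B).
Proof.
split.
  apply/asboolP; split=> [x|x y]; first exact: cvg_cst.
  by rewrite /= subr0.
move=> f g /asboolP[cf fB] /asboolP[cg gB]; apply/asboolP; split=> [x|x y].
  apply: (@continuous_comp _ _ _ (fun x => (f x, g x))
    (fun z : B * B => z.1 - z.2)).
    by apply: cvg_pair; [exact: cf|exact: cg].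
  exact: sub_continuous.
rewrite /= !fctE fB gB !opprB addrACA [in RHS]addrACA.
by congr (_ + _); rewrite addrC.
Qed.

HB.instance Definition _ :=
  GRing.isZmodClosed.Build (A -> B) (is_chom A B) is_chom_zmod_closed.

Record chom :=
  Chom { chom_fun :> A -> B; chom_subproof : chom_fun \in is_chom A B }.

HB.instance Definition _ := [isSub for chom_fun].
HB.instance Definition _ := [Choice of chom by <:].
HB.instance Definition _ := [SubChoice_isSubZmodule of chom by <:].

Lemma chom_continuous (f : chom) : continuous f.
Proof. by have /asboolP[] := chom_subproof f. Qed.

Lemma chom_zmod_morphism (f : chom) : zmod_morphism f.
Proof. by have /asboolP[] := chom_subproof f. Qed.

HB.instance Definition _ (f : chom) :=
  GRing.isZmodMorphism.Build A B f (chom_zmod_morphism f).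
End ContinuousHomomorphisms.

Section Precomposition.
Context (A B I : topologicalZmodType) (f : chom A B).

Let precomp_subproof (h : chom B I) : h \o f \in is_chom A I.
Proof.
apply/asboolP; split=> [x|x y]; last by rewrite /= !raddfB.
by apply: continuous_comp; exact: chom_continuous.
Qed.

(* Hom(f, I), for the contravariant functor Hom(-, I). *)
Definition precomp (h : chom B I) : chom A I := Chom (precomp_subproof h).

Let precomp_zmod_morphism : zmod_morphism precomp.
Proof. by move=> g h; apply: val_inj. Qed.

HB.instance Definition _ :=
  GRing.isZmodMorphism.Build (chom B I) (chom A I) precomp precomp_zmod_morphism.
End Precomposition.
Arguments precomp {A B} I f h.

Definition tiso (A B : topologicalZmodType) : Prop :=
  exists (f : chom A B) (g : chom B A), cancel f g /\ cancel g f.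

Definition short_exact (A B C : zmodType) (f : A -> B) (g : B -> C) : Prop :=
  [/\ injective f, range f = g @^-1` [set 0] & range g = [set: C]].

Definition homeo_onto_range (A B : topologicalType) (f : A -> B) : Prop :=
  [/\ injective f, continuous f &
      forall U, open U -> exists2 V, open V & f @` U = V `&` range f].

Definition tses (A B C : topologicalZmodType) (f : chom A B) (g : chom B C) :
    Prop :=
  [/\ short_exact f g, homeo_onto_range f & closed (range f)].

(* Ext(A, B) = 0: every extension 0 -> B -> X -> A -> 0 splits. *)
Definition Ext_eq0 (R : realType) (A B : topologicalZmodType) : Prop :=
  forall (X : topologicalZmodType) (f : chom B X) (g : chom X A),
    polish R X -> tses f g -> exists s : chom A X, cancel s g.

Definition int_subgroup (F : archiNumDomainType) : zmodClosed F :=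
  GRing.ZmodClosed.clone F (@Num.int_num_subdef F) _.

Definition circle (R : realType) : Type := tquot (int_subgroup R).
HB.instance Definition _ (R : realType) := TopologicalZmodule.on (circle R).

Section ProLie.
Context (R : realType).

Definition abelian_polish_lie (L : topologicalZmodType) : Prop :=
  polish R L /\
  exists (n d : nat) (D : zmodType), countable [set: D] /\
    tiso L (tdsum (tdsum {ptws 'I_n -> R} {ptws 'I_d -> circle R})
                  (discrete_topology D)).

(* The closed subgroups N satisfying [lie_cokernel] form the set N(G). *)
Definition lie_cokernel (G : topologicalZmodType) (N : zmodClosed G) : Prop :=
  closed [set` N] /\ abelian_polish_lie (tquot N).

Definition pro_lie (G : topologicalZmodType) : Prop :=
  polish R G /\
  forall U : set G, nbhs 0 U ->
    exists2 N : zmodClosed G, lie_cokernel N & [set` N] `<=` U.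

Definition topological_pgroup (p : nat) (A : topologicalZmodType) : Prop :=
  [/\ polish R A, locally_compact [set: A] &
      forall x : A, x *+ (p ^ n) @[n --> \oo] --> (0 : A)].

Definition pro_p (p : nat) (G : topologicalZmodType) : Prop :=
  pro_lie G /\
  forall M : zmodClosed G, lie_cokernel M ->
    exists N : zmodClosed G,
      [/\ lie_cokernel N, [set` N] `<=` [set` M] &
          topological_pgroup p (tquot N)].

Definition injective_PAb (p : nat) (I : topologicalZmodType) : Prop :=
  pro_p p I /\
  forall (A B C : topologicalZmodType) (f : chom A B) (g : chom B C),
    pro_p p A -> pro_p p B -> pro_p p C -> tses f g ->
    short_exact (precomp I g) (precomp I f).
End ProLie.

Definition divisible (G : zmodType) (H : set G) : Prop :=
  forall (n : nat) (x : G), (0 < n)%N -> H x -> exists2 y, H y & y *+ n = x.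

Definition divisible_basis0 (G : topologicalZmodType) : Prop :=
  forall U : set G, nbhs 0 U ->
    exists H : zmodClosed G,
      [/\ nbhs 0 [set` H], [set` H] `<=` U & divisible [set` H]].

Definition is_finsupp (A : zmodType) : {pred nat -> A} :=
  fun f => `[< finite_set [set i | f i != 0] >].
Arguments is_finsupp : clear implicits.

Section FiniteSupport.
Context (A : zmodType).

Let is_finsupp_zmod_closed : zmod_closed (is_finsupp A).
Proof.
split.
  apply/asboolP; apply: (@sub_finite_set _ _ set0) => // i /=.
  by rewrite eqxx.
move=> f g /asboolP ff /asboolP fg; apply/asboolP.
apply: (sub_finite_set (B := [set i | f i != 0] `|` [set i | g i != 0])).
  move=> i /=; have [fi0|] := eqVneq (f i) 0; last by left.
  have [gi0|] := eqVneq (g i) 0; last by right.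
  by rewrite !fctE fi0 gi0 subr0 eqxx.
by rewrite finite_setU.
Qed.

HB.instance Definition _ :=
  GRing.isZmodClosed.Build (nat -> A) (is_finsupp A) is_finsupp_zmod_closed.

(* The direct sum A^(omega); its topology, the discrete one, is put on it by
   the alias [discrete_topology]. *)
Record omega_sum :=
  OmegaSum { omega_sum_fun :> nat -> A; _ : omega_sum_fun \in is_finsupp A }.

HB.instance Definition _ := [isSub for omega_sum_fun].
HB.instance Definition _ := [Choice of omega_sum by <:].
HB.instance Definition _ := [SubChoice_isSubZmodule of omega_sum by <:].
End FiniteSupport.

Definition is_primary (p : nat) (A : zmodType) : {pred A} :=
  fun x => `[< exists n : nat, x *+ (p ^ n) = 0 >].
Arguments is_primary : clear implicits.

Section Primary.
Context (p : nat) (A : zmodType).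

Let is_primary_zmod_closed : zmod_closed (is_primary p A).
Proof.
split; first by apply/asboolP; exists 0; rewrite mul0rn.
move=> x y /asboolP[n xn] /asboolP[m ym]; apply/asboolP; exists (n + m)%N.
by rewrite mulrnBl expnD mulrnA xn mulnC mulrnA ym !mul0rn subr0.
Qed.

HB.instance Definition _ :=
  GRing.isZmodClosed.Build A (is_primary p A) is_primary_zmod_closed.

Record primary :=
  Primary { primary_val :> A; _ : primary_val \in is_primary p A }.

HB.instance Definition _ := [isSub for primary_val].
HB.instance Definition _ := [Choice of primary by <:].
HB.instance Definition _ := [SubChoice_isSubZmodule of primary by <:].
End Primary.

(* Z(p^oo) is taken to be the p-primary component of Q / Z. *)
Definition prufer (p : nat) : Type :=
  primary p (Quotient.quot (int_subgroup rat)).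
HB.instance Definition _ (p : nat) := GRing.Zmodule.on (prufer p).

(* An exponent alpha <= omega is an [option nat], with [None] for omega;
   [upto alpha] has cardinality alpha. *)
Definition upto (alpha : option nat) : Type :=
  if alpha is Some n then 'I_n else nat.

(* Main.v *)
(* A pro-p Polish group G has a basis of open subgroups U n with G / U n a
   countable p-group. With D the direct sum of countably many copies of
   Z(p^oo), embedding each G / U n in D embeds G as a closed subgroup of
   A = D^omega. The quotient A / G is decomposed layer by layer along its
   filtration: each layer is a divisible countable p-group, hence a direct sum
   of copies of Z(p^oo), and splits off. This gives an exact sequence
   0 -> G -> A -> A -> 0, and the same decomposition applied to G itself gives
   (2) => (3). Homomorphisms into a divisible discrete group extend along
   embeddings into groups with a basis of open subgroups, and so do those into
   products of such groups, so A and its retracts are injective. Thus (1) and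
   (4) both amount to G being a retract of A, which also yields (2). For
   (3) => (4) the extension X is only known to be Polish: the open mapping
   theorem for Polish groups shows that X -> A is open, hence that X has a basis
   of open subgroups. *)

Require Import Defs.
From HB Require Import structures.
From mathcomp Require Import all_boot all_order all_algebra.
From mathcomp Require Import all_classical all_reals all_analysis.
From mathcomp Require Import zify lra.
Import Order.TTheory GRing.Theory Num.Theory.
Import numFieldNormedType.Exports.

Set Implicit Arguments.
Unset Strict Implicit.
Unset Printing Implicit Defensive.

Local Open Scope classical_set_scope.
Local Open Scope ring_scope.
Local Open Scope quotient_scope.

(** * Subgroups and extension of homomorphisms *)

(** The definition of a pro-p group speaks of Lie quotients. Open subgroups enter because the line
    and the circle contain points [x] for which [p ^ n] times [x] does not tend to 0, so a Lie
    quotient that is a topological p-group is discrete. The quotient [A / G] is never formed: a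
    layer is a pair of subgroups [N] and [K] of an ambient group, and its coordinates are
    homomorphisms on the whole ambient group, provided by divisibility of the target. No complement
    has to be chosen. A point with prescribed coordinates is found by successive corrections, so the
    filtration must be complete for the group structure, whereas a Polish metric need not be
    invariant; bridging this gap is the main analytic obstacle. The rank of a layer matters twice.
    In the resolution all ranks are forced to be infinite, so that the quotient is [A] itself and
    not an unknown product. In the decomposition of [G], a layer of finite rank is broken up into
    single copies of Z(p^oo), which enter the first power, and a layer of infinite rank gives one
    factor of the second. *)

Lemma subrACA (M : zmodType) (x y z t : M) :
  (x - y) - (z - t) = (x - z) - (y - t).
Proof. by rewrite !opprD addrACA. Qed.

(** A predicate on sets and not a structure, because most subgroups arise inside proofs, by
    recursion or choice; [zmodClosed_of_subgroup] packs one when a quotient or the main statement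
    asks for it. *)
Definition subgroup (M : zmodType) (K : set M) : Prop :=
  K 0 /\ forall x y, K x -> K y -> K (x - y).

Section Subgroups.
Context (M : zmodType).
Implicit Types (K : set M) (x y : M).

Lemma subgroup0 K : subgroup K -> K 0. Proof. by case. Qed.

Lemma subgroupB K x y : subgroup K -> K x -> K y -> K (x - y).
Proof. by case=> _; apply. Qed.

Lemma subgroupN K x : subgroup K -> K x -> K (- x).
Proof. by case=> K0 KB Kx; rewrite -sub0r; apply: KB. Qed.

Lemma subgroupD K x y : subgroup K -> K x -> K y -> K (x + y).
Proof. by move=> sK Kx Ky; rewrite -[y]opprK; apply: subgroupB => //;
  exact: subgroupN. Qed.

Lemma subgroupMn K x n : subgroup K -> K x -> K (x *+ n).
Proof.
move=> sK Kx; elim: n => [|n IH]; first exact: subgroup0.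
by rewrite mulrS; apply: subgroupD.
Qed.

Lemma subgroupMz K x m : subgroup K -> K x -> K (x *~ m).
Proof.
move=> sK Kx; case: m => n; first exact: subgroupMn.
by rewrite NegzE mulrNz; apply: subgroupN => //; exact: subgroupMn.
Qed.

Lemma subgroup_subC K x y : subgroup K -> K (x - y) -> K (y - x).
Proof. by move=> sK Kxy; rewrite -opprB; exact: subgroupN. Qed.

Lemma subgroup_coset K x y : subgroup K -> K (x - y) -> K x <-> K y.
Proof.
move=> sK Kxy; split=> [Kx|Ky]; last by rewrite -(subrK y x); exact: subgroupD.
by rewrite -(subKr x y); exact: subgroupB.
Qed.

Lemma subgroup_zmodClosed (N : zmodClosed M) : subgroup [set` N].
Proof. by split=> [|x y] /=; [exact: rpred0|exact: rpredB]. Qed.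

Lemma zmodClosed_of_subgroup K :
  subgroup K -> exists N : zmodClosed M, [set` N] = K.
Proof.
move=> sK; pose P : {pred M} := fun x => `[< K x >].
have Pz : zmod_closed P.
  split; first by apply/asboolP; exact: subgroup0.
  by move=> x y /asboolP Kx /asboolP Ky; apply/asboolP; exact: subgroupB.
pose N : zmodClosed M := HB.pack P (GRing.isZmodClosed.Build M P Pz).
exists N; apply/seteqP; split=> x /=; first by move/asboolP.
by move=> Kx; apply/asboolP.
Qed.

Definition sumset K L : set M := [set x | exists2 a, K a & L (x - a)].

Lemma sumset_subgroup K L : subgroup K -> subgroup L -> subgroup (sumset K L).
Proof.
move=> sK sL; split=> [|x y [a Ka Lxa] [b Kb Lyb]].
  by exists 0; [exact: subgroup0|rewrite subr0; exact: subgroup0].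
exists (a - b); first exact: subgroupB.
by rewrite subrACA; exact: subgroupB.
Qed.

Lemma subset_sumsetl K L : subgroup L -> K `<=` sumset K L.
Proof. by move=> sL x Kx; exists x => //; rewrite subrr; exact: subgroup0. Qed.

Lemma subset_sumsetr K L : subgroup K -> L `<=` sumset K L.
Proof. by move=> sK x Lx; exists 0; [exact: subgroup0|rewrite subr0]. Qed.

End Subgroups.

Lemma zmod_morphism_additive (M D : zmodType) (h : M -> D) :
  zmod_morphism h -> exists h' : {additive M -> D}, h' = h :> (M -> D).
Proof.
move=> hB.
by exists (HB.pack h (GRing.isZmodMorphism.Build M D h hB) : {additive M -> D}).
Qed.

Section Extension.
Context (M D : zmodType) (divD : divisible [set: D]).
Implicit Type Gamma : set (M * D).

(** The graph of a homomorphism from a subgroup of [M] to [D]. Sets of pairs can be united along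
    chains without dependent domains, and for a subgroup single-valuedness need only be tested at
    0. *)
Definition partial_hom Gamma :=
  [/\ Gamma (0, 0),
      forall x y x' y', Gamma (x, y) -> Gamma (x', y') ->
        Gamma (x - x', y - y') &
      forall d, Gamma (0, d) -> d = 0].

Definition adjoin Gamma (x : M) (y : D) : set (M * D) :=
  [set u | exists m : int, Gamma (u.1 - x *~ m, u.2 - y *~ m)].

Lemma adjoin_partial_hom Gamma x y :
    partial_hom Gamma -> (forall m d, Gamma (x *~ m, d) -> d = y *~ m) ->
  partial_hom (adjoin Gamma x y).
Proof.
move=> [G0 GB _] Gxy; split.
- by exists 0; rewrite !mulr0z !subr0.
- move=> a b a' b' [m /= Gm] [m' /= Gm']; exists (m - m') => /=.
  by have := GB _ _ _ _ Gm Gm'; rewrite (subrACA a) (subrACA b) -!mulrzBr.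
- move=> d [m /=]; rewrite sub0r => /(GB _ _ _ _ G0) /=.
  rewrite sub0r opprK sub0r opprB => /Gxy /eqP.
  by rewrite -subr_eq0 addrAC subrr sub0r oppr_eq0 => /eqP.
Qed.

(** Baer's argument. The multiples of [x] in the domain are those of a least [n], and dividing the
    value at [x *+ n] by [n] gives [y]. If no positive multiple lies in the domain, any [y] is
    compatible and 0 is taken. *)
Lemma partial_hom_solve Gamma x : partial_hom Gamma ->
  exists y, forall m d, Gamma (x *~ m, d) -> d = y *~ m.
Proof.
move=> [G0 GB Gf].
have GN u v : Gamma (u, v) -> Gamma (- u, - v).
  by move=> /(GB _ _ _ _ G0); rewrite !sub0r.
have GMz u v m : Gamma (u, v) -> Gamma (u *~ m, v *~ m).
  move=> Guv; have Gn n : Gamma (u *+ n, v *+ n).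
    elim: n => [//|n IH].
    by have := GB _ _ _ _ IH (GN _ _ Guv); rewrite !mulrSr !opprK.
  by case: m => n; [exact: Gn|rewrite NegzE !mulrNz; apply: GN; exact: Gn].
have [[n n0 [d0 Gn]]|noG] :=
    pselect (exists2 n, (0 < n)%N & exists d, Gamma (x *+ n, d)).
  have exn : exists n, (0 < n)%N && `[< exists d, Gamma (x *+ n, d) >].
    by exists n; rewrite n0; apply/asboolP; exists d0.
  case: (ex_minnP exn) => {n n0 d0 Gn}n /andP[n0 /asboolP[d0 Gn]] nmin.
  have [y _ yn] := divD n0 (I : [set: D] d0).
  exists y => m d Gm.
  have nz : n%:Z != 0 by rewrite eqz_nat -lt0n.
  have := GB _ _ _ _ Gm (GMz _ _ (m %/ n)%Z Gn).
  rewrite [x *+ n]pmulrn -mulrzA -mulrzBr (mulrC n%:Z).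
  have -> : m - (m %/ n)%Z * n%:Z = `|(m %% n)%Z|%N%:Z.
    by rewrite gez0_abs ?modz_ge0// {1}(divz_eq m n) addrC addKr.
  (* The remainder of [m] modulo [n] is again a multiple of [x] in the domain, so minimality of [n]
     makes it 0. *)
  set r := `|_|%N => Gr.
  have r0 : r = 0.
    apply/eqP; rewrite -leqn0 leqNgt; apply/negP => r0.
    have := nmin r; rewrite r0/= => /(_ _)/wrap[].
      by apply/asboolP; exists (d - d0 *~ (m %/ n)%Z).
    by rewrite leqNgt -ltz_nat gez0_abs ?modz_ge0// ltz_pmod.
  move: Gr; rewrite r0 mulr0z => /Gf/eqP; rewrite subr_eq0 => /eqP ->.
  rewrite -yn pmulrn -mulrzA; congr (_ *~ _).
  have : (m %% n)%Z = 0 by apply/eqP; rewrite -absz_eq0 -/r r0.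
  by move=> m0; rewrite [X in _ = X](divz_eq m n) m0 addr0 mulrC.
exists 0 => m d; rewrite mul0rz.
have noGn n v : Gamma (x *+ n, v) -> n = 0.
  move=> Gn; apply/eqP; rewrite -leqn0 leqNgt; apply/negP => n0.
  by apply: noG; exists n => //; exists v.
case: m => n Gm; first by have n0 := noGn n d Gm; apply: Gf; move: Gm;
  rewrite n0 mulr0z.
by move: Gm => /GN; rewrite NegzE mulrNz opprK => /noGn.
Qed.

(** Divisible groups are injective: by Zorn's lemma there is a maximal graph, and
    [partial_hom_solve] would enlarge it if its domain were not all of [M]. *)
Lemma partial_hom_extension Gamma : partial_hom Gamma ->
  exists h : {additive M -> D}, forall x y, Gamma (x, y) -> h x = y.
Proof.
move=> GP.
(* The condition bears on the union with [Gamma], so that the empty chain, whose union is empty,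
   satisfies it too. *)
pose P := [set X : set (M * D) | partial_hom (X `|` Gamma)].
have [F FP Ftot|X [XP Xmax]] := @Zorn_bigcup _ P.
  case: (GP) => G0 GB Gf; split; first by right.
    move=> x y x' y' [[X FX Xu]|Gu] [[Y FY Yv]|Gv]; last by right; exact: GB.
    - have [XY|YX] := Ftot _ _ FX FY.
        have [_ /(_ x y x' y') YB _] := FP _ FY.
        have [|||] := YB; [by left; apply: XY|by left| |by right].
        by move=> ?; left; exists Y.
      have [_ /(_ x y x' y') XB _] := FP _ FX.
      have [|||] := XB; [by left|by left; apply: YX| |by right].
      by move=> ?; left; exists X.
    - have [_ /(_ x y x' y') XB _] := FP _ FX.
      have [|||] := XB; [by left|by right| |by right].
      by move=> ?; left; exists X.
    - have [_ /(_ x y x' y') YB _] := FP _ FY.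
      have [|||] := YB; [by right|by left| |by right].
      by move=> ?; left; exists Y.
  move=> d [[X FX Xd]|]; last exact: Gf.
  by have [_ _ Xf] := FP _ FX; apply: Xf; left.
set A := X `|` Gamma in XP *; rewrite /= -/A in XP.
have Atot x : exists y, A (x, y).
  have [y yP] := partial_hom_solve x XP; exists y.
  have [A0 AB Af] := XP.
  have BP := adjoin_partial_hom XP yP.
  have AB' : A `<=` adjoin A x y.
    by move=> [a b] Aab; exists 0; rewrite /= !mulr0z !subr0.
  apply: contrapT => nAxy; apply: (Xmax (adjoin A x y)).
    split; first by move=> u Xu; apply: AB'; left.
    move=> /(_ (x, y)) BX; apply: nAxy; left; apply: BX.
    by exists 1; rewrite /= !mulr1z !subrr.
  rewrite /P/=; suff -> : adjoin A x y `|` Gamma = adjoin A x y by [].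
  by apply/setUidPl => u Gu; apply: AB'; right.
have [h hP] := choice Atot; have [A0 AB Af] := XP.
have Afun x y y' : A (x, y) -> A (x, y') -> y = y'.
  move=> Ay Ay'; apply/eqP; rewrite -subr_eq0; apply/eqP/Af.
  by have := AB _ _ _ _ Ay Ay'; rewrite subrr.
have hB : zmod_morphism h.
  by move=> x y; apply: (Afun (x - y)); [exact: hP|apply: AB; exact: hP].
have [h' h'E] := zmod_morphism_additive hB.
by exists h' => x y Gxy; rewrite h'E; apply: (Afun x) => //; right.
Qed.

End Extension.

(** * The Pruefer group and direct sums *)

(** Write [n] as a power of [p] times a factor [m] prime to [p]. By Bezout [m] acts invertibly on an
    element killed by [p ^ k], and the power of [p] is divided out one factor at a time. *)
Lemma divisible_primary (p : nat) (A : zmodType) : prime p ->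
    (forall x : A, exists n, x *+ (p ^ n) = 0) ->
    (forall x : A, exists y, y *+ p = x) ->
  divisible [set: A].
Proof.
move=> p_prime pA divp n x n0 _.
have divpn k : forall y : A, exists z, z *+ (p ^ k) = y.
  elim: k => [|k IH] y; first by exists y.
  have [z <-] := divp y; have [w <-] := IH z.
  by exists w; rewrite expnSr mulrnA.
have [k xk] := pA x.
have [m cop nE] := pfactor_coprime p_prime n0.
have m0 : (0 < m)%N by move: n0; rewrite nE; case: (m).
have : coprime m (p ^ k) by rewrite coprime_sym coprimeXl.
case/(coprimeP _ m0) => u uE.
have xE : (x *+ u.1) *+ m = x.
  have uE' : (u.1 * m)%N = (1 + u.2 * p ^ k)%N by lia.
  by rewrite -mulrnA uE' mulrnDr mulr1n mulnC mulrnA xk mul0rn addr0.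
have [y yE] := divpn (logn p n) (x *+ u.1).
by exists y => //; rewrite nE mulnC mulrnA yE.
Qed.

Local Notation QZ := (Quotient.quot (int_subgroup rat)).

Lemma pi_QZ_eq0 (q : rat) : \pi_QZ q = 0 <-> q \is a Num.int.
Proof.
have /= E := Quotient.idealrBE (int_subgroup rat) q 0; rewrite subr0 in E.
rewrite -[q \is a _]/(q \in int_subgroup rat) E.
have -> : \pi_QZ 0 = 0 :> QZ by rewrite raddf0.
by split=> /eqP.
Qed.

Lemma pi_QZMn (q : rat) n : \pi_QZ q *+ n = \pi_QZ (q * n%:R).
Proof. by rewrite mulr_natr raddfMn. Qed.

Lemma prufer_torsion p (x : prufer p) : exists n, x *+ (p ^ n) = 0.
Proof.
have /asboolP[n xn] := valP x; exists n; apply: val_inj.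
by rewrite raddfMn xn raddf0.
Qed.

Lemma prufer_divisible (p : nat) : prime p -> divisible [set: prufer p].
Proof.
move=> p_prime; apply: (divisible_primary p_prime) => x.
  exact: prufer_torsion.
have [n xn] := prufer_torsion x.
pose q := repr (val x : QZ).
have yP : \pi_QZ (q / p%:R) *+ p = val x.
  rewrite pi_QZMn divfK ?reprK// pnatr_eq0.
  by rewrite -lt0n prime_gt0.
have yp : \pi_QZ (q / p%:R) \in is_primary p QZ.
  apply/asboolP; exists n.+1; rewrite expnS mulrnA yP.
  by rewrite -[LHS](raddfMn (val : prufer p -> QZ)) xn raddf0.
by exists (Primary yp); apply: val_inj; rewrite raddfMn.
Qed.

(** The generator is the class of 1/p: if [p] kills the class of [q], then [q * p] is an integer
    [m], and [q] is [m] times 1/p. *)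
Lemma prufer_socle (p : nat) : prime p -> exists c : prufer p,
  [/\ c != 0, c *+ p = 0 & forall x, x *+ p = 0 -> exists m, x = c *~ m].
Proof.
move=> p_prime; have p0 : p%:R != 0 :> rat by rewrite pnatr_eq0 -lt0n prime_gt0.
have cP : \pi_QZ p%:R^-1 *+ p = 0 :> QZ.
  by rewrite pi_QZMn; apply/pi_QZ_eq0; rewrite mulVf.
have cp : \pi_QZ p%:R^-1 \in is_primary p QZ.
  by apply/asboolP; exists 1; rewrite expn1.
exists (Primary cp); split.
- apply/eqP => /(congr1 val)/= /pi_QZ_eq0 /intrP[m].
  move=> /(congr1 (fun x => x * p%:R)); rewrite mulVf// => /esym/eqP.
  rewrite -[X in _ * X]/(p%:Z%:~R) -intrM -[1]/(1%:~R) eqr_int =>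
    /eqP /(congr1 absz).
  rewrite abszM/= => /eqP; rewrite muln_eq1 => /andP[_ /eqP p1].
  by rewrite p1 in p_prime.
- by apply: val_inj; rewrite raddfMn.
- move=> x xp; pose q := repr (val x : QZ).
  have /pi_QZ_eq0 /intrP[m qm] : \pi_QZ (q * p%:R) = 0.
    rewrite -pi_QZMn reprK.
    by rewrite -[LHS](raddfMn (val : prufer p -> QZ)) xp raddf0.
  exists m; apply: val_inj; rewrite raddfMz/= -raddfMz -[LHS]reprK -/q.
  congr (\pi_QZ _); apply: (mulIf p0); rewrite qm.
  by rewrite -[p%:R^-1 *~ m]mulrzr mulrAC mulVf// mul1r.
Qed.

Lemma prufer_countable p : countable [set: prufer p].
Proof.
apply/countable_injP; exists (fun x => pickle (repr (val x : QZ))).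
move=> x y _ _ /(pcan_inj pickleK) xy; apply: val_inj.
by rewrite -[LHS](reprK (val x : QZ)) -[RHS](reprK (val y : QZ)) xy.
Qed.

Lemma countable_enum (T : zmodType) : countable [set: T] ->
  exists e : nat -> T, forall x, exists j, e j = x.
Proof.
move=> /countable_injP[f finj]; exists (fun j => xget 0 [set x | f x = j]).
move=> x; exists (f x).
case: xgetP => [y _ /= fy|/(_ x)/(_ erefl)//].
by apply: finj; rewrite ?in_setT.
Qed.

Section OmegaSum.
Context (A : zmodType).
Implicit Types (f g : omega_sum A) (S : set nat).

Lemma omega_sum_eq f g : (forall i, f i = g i) -> f = g.
Proof. by move=> fg; apply: val_inj; apply/funext. Qed.

Lemma omega_sumB f g i : (f - g) i = f i - g i. Proof. by []. Qed.

Lemma omega_sumN f i : (- f) i = - f i. Proof. by []. Qed.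

Lemma omega_sumD f g i : (f + g) i = f i + g i. Proof. by []. Qed.

Lemma omega_sumMn f n i : (f *+ n) i = f i *+ n.
Proof. by elim: n => [//|n IH]; rewrite !mulrS omega_sumD IH. Qed.

Lemma omega_sumMz f m i : (f *~ m) i = f i *~ m.
Proof. by case: m => n; rewrite ?NegzE ?mulrNz ?omega_sumN omega_sumMn. Qed.

Lemma omega_sum_bound f : exists n, forall i, (n <= i)%N -> f i = 0.
Proof.
have /asboolP/finite_seqP[X XE] := valP f.
exists (\max_(i <- X) i).+1 => i Xi; apply: contrapT => /eqP fi.
have : i \in X by have : [set` X] i by rewrite -XE.
by move=> /(@leq_bigmax_seq _ _ xpredT id) => /(_ isT); rewrite leqNgt Xi.
Qed.

Lemma omega_sum_intro (f : nat -> A) n : (forall i, (n <= i)%N -> f i = 0) ->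
  exists g : omega_sum A, forall i, g i = f i.
Proof.
move=> f0; have fP : f \in is_finsupp A.
  apply/asboolP/(sub_finite_set _ (finite_II n)) => i /= fi.
  by rewrite ltnNge; apply: contra fi => ni; rewrite f0.
by exists (OmegaSum fP).
Qed.

Lemma omega_sum_countable : countable [set: A] -> countable [set: omega_sum A].
Proof.
move=> /countable_injP[g ginj]; have [b bP] := choice omega_sum_bound.
apply/countable_injP; exists (fun f => pickle (mkseq (g \o f) (b f))).
move=> f f' _ _ /(pcan_inj pickleK) ff'.
have bE : b f = b f' by have := congr1 size ff'; rewrite !size_mkseq.
apply: omega_sum_eq => i; have [bi|ib] := leqP (b f) i.
  by rewrite !bP// -bE.
apply: ginj; rewrite ?in_setT//.
by have := congr1 (nth 0 ^~ i) ff'; rewrite !nth_mkseq -?bE.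
Qed.

Lemma omega_sum_divisible : divisible [set: A] -> divisible [set: omega_sum A].
Proof.
move=> divA n f n0 _.
(* The chosen root of 0 is 0, so taking roots in each coordinate keeps the support finite. *)
have /choice[g gP] : forall x : A, exists y, y *+ n = x /\ (x = 0 -> y = 0).
  move=> x; have [->|x0] := eqVneq x 0; first by exists 0; rewrite mul0rn.
  have [y _ yx] := divA n x n0 I.
  by exists y; split=> // x0'; rewrite x0' eqxx in x0.
have [b bP] := omega_sum_bound f.
have [|h hE] := @omega_sum_intro (g \o f) b.
  by move=> i bi /=; apply: (gP _).2; exact: bP.
by exists h => //; apply: omega_sum_eq => i; rewrite omega_sumMn hE;
  case: (gP (f i)).
Qed.

Definition restr_fun S (f : nat -> A) i : A := if `[< S i >] then f i else 0.

Lemma restr_subproof S f : restr_fun S f \in is_finsupp A.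
Proof.
have [b bP] := omega_sum_bound f.
have [|h hE] := @omega_sum_intro (restr_fun S f) b.
  by move=> i bi; rewrite /restr_fun bP// if_same.
have -> : restr_fun S f = h by apply/funext => i; rewrite hE.
exact: (valP h).
Qed.

Definition restr S f : omega_sum A := OmegaSum (restr_subproof S f).

Lemma restr_zmod S : zmod_morphism (restr S).
Proof.
move=> f g; apply: omega_sum_eq => i; rewrite omega_sumB /= /restr_fun.
by case: asboolP => // _; rewrite subr0.
Qed.

HB.instance Definition _ S :=
  GRing.isZmodMorphism.Build (omega_sum A) (omega_sum A)
    (restr S) (restr_zmod S).

Lemma restr_in S f i : S i -> restr S f i = f i.
Proof. by move=> Si /=; rewrite /restr_fun; case: asboolP. Qed.

Lemma restr_out S f i : ~ S i -> restr S f i = 0.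
Proof. by move=> Si /=; rewrite /restr_fun; case: asboolP. Qed.

End OmegaSum.

Lemma omega_sum_prufer_torsion p (f : omega_sum (prufer p)) :
  exists k, f *+ (p ^ k) = 0.
Proof.
have [n fn] := omega_sum_bound f;
  have /choice[l lP] := fun i => prufer_torsion (f i).
exists (\sum_(i < n) l i)%N; apply: omega_sum_eq => i.
rewrite omega_sumMn; have [/fn->|ni] := leqP n i; first by rewrite mul0rn.
by rewrite (bigD1 (Ordinal ni))//= expnD mulrnA lP mul0rn.
Qed.

(** * Countable p-groups modulo a subgroup *)

(** Modulo [V] the element [b] has order exactly [p]: were [m] prime to [p], Bezout would write [b]
    as a combination of [b *+ p] and [b *~ m], both in [V]. *)
Lemma order_prime (M : zmodType) (p : nat) : prime p ->
  forall (V : set M) b, subgroup V -> V (b *+ p) -> ~ V b ->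
  forall m, V (b *~ m) -> exists k, m = k * p%:Z.
Proof.
move=> p_prime V b sV Vbp nVb m Vbm; apply/dvdzP; rewrite dvdzE/=.
apply: contrapT => /negP; rewrite -prime_coprime// => cop; apply: nVb.
have Vbn : V (b *+ `|m|).
  move: Vbm; case: m {cop} => n //=; rewrite NegzE mulrNz => /(subgroupN sV).
  by rewrite opprK.
have /(coprimeP _ (prime_gt0 p_prime))[u uE] := cop.
have uE' : (u.1 * p)%N = (1 + u.2 * `|m|)%N by lia.
have -> : b = b *+ (u.1 * p) - b *+ (u.2 * `|m|).
  by rewrite uE' mulrnDr mulr1n addrK.
by rewrite mulnC mulrnA mulnC mulrnA; apply: subgroupB => //; exact: subgroupMn.
Qed.

(** * Coordinates on a countable p-group [K / N], through its socle *)

Section SocleBasis.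
Context (p : nat) (p_prime : prime p) (M : zmodType) (N K : set M).
Hypotheses (sN : subgroup N) (sK : subgroup K) (NK : N `<=` K).
Variable e : nat -> M.
Hypothesis eP : forall x, exists j, N (x - e j).
Hypothesis pK : forall x, K x -> exists n, N (x *+ (p ^ n)).

(** The preimage in [K] of the p-socle of [K / N], a vector space over the field with [p]
    elements. *)
Definition socle_mod : set M := [set x | K x /\ N (x *+ p)].
Local Notation Sigma := socle_mod.

Lemma socle_mod_subgroup : subgroup Sigma.
Proof.
split; first by split; [exact: subgroup0|rewrite mul0rn; exact: subgroup0].
move=> x y [Kx Nx] [Ky Ny]; split; first exact: subgroupB.
by rewrite mulrnBl; exact: subgroupB.
Qed.

Lemma sub_socle_mod : N `<=` Sigma.
Proof. by move=> x Nx; split; [exact: NK|exact: subgroupMn]. Qed.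

Lemma socle_mod_enum : exists d : nat -> M,
  (forall j, Sigma (d j)) /\ forall x, Sigma x -> exists j, N (x - d j).
Proof.
exists (fun j => xget 0 [set x | Sigma x /\ N (x - e j)]); split=> [j|x Sx].
  by case: xgetP => [y _ []//|_]; apply: subgroup0 socle_mod_subgroup.
have [j Nj] := eP x; exists j;
  case: xgetP => [y _ [_ Ny]|/(_ x)/(_ (conj Sx Nj))//].
by rewrite -(subrKA (e j)); apply: subgroupD => //; exact: subgroup_subC.
Qed.

Definition add_gen (V : set M) (b : M) : set M :=
  [set x | exists m : int, V (x - b *~ m)].

Lemma add_gen_subgroup V b : subgroup V -> subgroup (add_gen V b).
Proof.
move=> sV; split; first by exists 0; rewrite mulr0z subrr; exact: subgroup0.
move=> x y [m Vx] [n Vy]; exists (m - n).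
by rewrite mulrzBr subrACA; exact: subgroupB.
Qed.

Lemma sub_add_gen (V : set M) b : V `<=` add_gen V b.
Proof. by move=> x Vx; exists 0; rewrite mulr0z subr0. Qed.

Lemma add_gen_gen (V : set M) b : subgroup V -> add_gen V b b.
Proof. by move=> sV; exists 1; rewrite mulr1z subrr; exact: subgroup0. Qed.

(* At stage [n] the [n]-th element of the socle is adjoined or, if it already
   lies in [V n], any new one: thus the indices of the elements that enlarge
   the chain form an initial segment of [nat]. *)
Lemma socle_chain : exists (V : nat -> set M) (b : nat -> M),
  [/\ V 0%N = N, forall n, V n.+1 = add_gen (V n) (b n),
      forall n, Sigma (b n), forall x, Sigma x -> exists n, V n x &
      forall n, V n (b n) -> Sigma `<=` V n].
Proof.
have [d [dS dP]] := socle_mod_enum.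
(* Once [V] contains the whole socle, [xget] returns its default 0 and the chain stays constant. *)
pose c n (V : set M) := if `[< V (d n) >] then xget 0 (Sigma `\` V) else d n.
pose V := fix V n := if n is m.+1 then add_gen (V m) (c m (V m)) else N.
have sV n : subgroup (V n) by elim: n => [//|n IH]; exact: add_gen_subgroup.
have NV n : N `<=` V n.
  by elim: n => [//|n IH] x Nx; apply: sub_add_gen; exact: IH.
exists V, (fun n => c n (V n)); split=> //.
- move=> n; rewrite /c; case: asboolP => _; last exact: dS.
  case: xgetP => [y _ []//|_]; exact: subgroup0 socle_mod_subgroup.
- move=> x /dP[j Nj]; exists j.+1; apply/(subgroup_coset (sV _) (NV _ _ Nj)).
  have [Vd|nVd] := pselect (V j (d j)); first exact: sub_add_gen.
  by rewrite /= /c asboolF//; exact: add_gen_gen.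
- move=> n; rewrite /c; case: asboolP => // Vd.
  case: xgetP => [y _ [Sy nVy]//|noV _ x Sx].
  by apply: contrapT => nVx; apply: (noV x).
Qed.

(** The map that is 0 on [V] and sends [b] to [c] is well defined, because [b] has order [p] modulo
    [V] and [p] kills [c]; divisibility of the Pruefer group extends it to [M]. *)
Lemma partial_hom_add_gen (V : set M) b (c : prufer p) :
    subgroup V -> V (b *+ p) -> ~ V b -> c *+ p = 0 ->
  exists h : {additive M -> prufer p}, (forall x, V x -> h x = 0) /\ h b = c.
Proof.
move=> sV Vbp nVb cp; have Vb := @order_prime _ _ p_prime V b sV Vbp nVb.
pose G0 : set (M * prufer p) := [set u | V u.1 /\ u.2 = 0].
have G0P : partial_hom G0.
  split; first by split=> //; exact: subgroup0.
    move=> x y x' y' [/= Vx ->] [/= Vx' ->].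
    by split; rewrite /= ?subr0//; exact: subgroupB.
  by move=> d [].
have [|h hP] := partial_hom_extension (prufer_divisible p_prime)
    (@adjoin_partial_hom _ _ _ b c G0P _).
  move=> m d [/= /Vb[k ->] ->]; rewrite mulrC mulrzA -pmulrn cp.
  by rewrite mul0rz.
exists h; split=> [x Vx|].
  by apply: hP; exists 0; rewrite !mulr0z !subr0; split.
by apply: hP; exists 1; rewrite /= !mulr1z !subrr; split=> //; exact: subgroup0.
Qed.

Lemma add_gen_finite (V : set M) b (L : seq M) :
    N (b *+ p) -> (forall x, V x -> exists2 a, a \in L & N (x - a)) ->
  exists L' : seq M, forall x, add_gen V b x -> exists2 a, a \in L' & N (x - a).
Proof.
move=> Nbp VL; exists [seq a + b *+ k | a <- L, k <- iota 0 p].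
move=> x [m /VL[a aL Nxa]].
have p0 : p%:Z != 0 by rewrite eqz_nat -lt0n prime_gt0.
exists (a + b *+ `|(m %% p)%Z|).
  apply/allpairsP; exists (a, `|(m %% p)%Z|%N); split=> //=.
  by rewrite mem_iota/= -ltz_nat gez0_abs ?modz_ge0// ltz_pmod// ltz_nat
    prime_gt0.
have -> : x - (a + b *+ `|(m %% p)%Z|) = (x - b *~ m - a) + b *+ p *~
  (m %/ p)%Z.
  have {1}-> : b *~ m = b *+ p *~ (m %/ p)%Z + b *+ `|(m %% p)%Z|.
    rewrite !pmulrn gez0_abs ?modz_ge0// -mulrzA -mulrzDr mulrC.
    by congr (_ *~ _); exact: divz_eq.
  rewrite -[RHS]addrA [- a + _]addrC [b *+ p *~ _ + b *+ _]addrC [in RHS]opprD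
    (addrA x _ (- _)).
  by rewrite subrKA opprD addrA addrAC.
by apply: subgroupD => //; exact: subgroupMz.
Qed.

(* The functional [chi n] kills [V n] and does not kill [b n], so on the socle
   only finitely many of them are nonzero at each element; the resulting
   isomorphism of socles extends to [rho] because the target is divisible. *)
Theorem socle_basis :
  exists (S : set nat) (rho : {additive M -> omega_sum (prufer p)}),
  [/\ forall x, N x -> rho x = 0,
      forall x, K x -> rho x = 0 -> N x,
      forall x i, ~ S i -> rho x i = 0,
      (forall x, K x -> exists2 y, K y & N (x - y *+ p)) ->
        forall f : omega_sum (prufer p),
          (forall i, ~ S i -> f i = 0) -> exists2 x, K x & rho x = f &
      S = setT \/
      finite_set S /\ exists L : seq M,
        forall x, Sigma x -> exists2 a, a \in L & N (x - a)].
Proof.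
have [V [b [V0 VS bS SV bV]]] := socle_chain.
have sV n : subgroup (V n).
  elim: n => [|n IH]; first by rewrite V0.
  by rewrite VS; exact: add_gen_subgroup.
have Vmono m n : (m <= n)%N -> V m `<=` V n.
  move=> /subnK <-; elim: (n - m)%N => [//|k IH] x /IH Vx.
  by rewrite addSn VS; exact: sub_add_gen.
have NV n : N `<=` V n by rewrite -V0; exact: Vmono.
pose S : set nat := [set n | ~ V n (b n)].
have [c [c0 cp csoc]] := prufer_socle p_prime.
have /choice[chi chiP] : forall n, exists h : {additive M -> prufer p},
    (forall x, V n x -> h x = 0) /\ (S n -> h (b n) = c) /\
      (~ S n -> forall x, h x = 0).
  move=> n; have [Vb|nVb] := pselect (V n (b n)).
    by exists \0.
  have [h [h1 h2]] := @partial_hom_add_gen (V n) (b n) c (sV n)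
    (NV _ _ (bS n).2) nVb cp.
  by exists h.
have divO := omega_sum_divisible (prufer_divisible p_prime).
pose G : set (M * omega_sum (prufer p)) :=
  [set u : M * omega_sum (prufer p) |
    Sigma u.1 /\ forall i, u.2 i = chi i u.1].
have GP : partial_hom G.
  split; first by split=> [|i]; rewrite ?raddf0//;
    exact: subgroup0 socle_mod_subgroup.
    move=> x y x' y' [/= Sx yx] [/= Sx' yx']; split=> [|i].
      exact: subgroupB socle_mod_subgroup _ _.
    by rewrite raddfB -yx -yx'.
  by move=> d [_ /= d0]; apply: omega_sum_eq => i; rewrite d0 raddf0.
have [h hP] := partial_hom_extension divO GP.
pose rho : {additive M -> omega_sum (prufer p)} := restr S \o h.
have rhoE x : rho x = restr S (h x) by [].
have hchi x i : Sigma x -> h x i = chi i x.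
  move=> Sx; have [n Vn] := SV _ Sx.
  have [|f fE] := @omega_sum_intro _ (fun i => chi i x) n.
    by move=> k nk; apply: (chiP k).1; exact: Vmono Vn.
  by rewrite (hP x f).
have rhochi x i : Sigma x -> rho x i = chi i x.
  move=> Sx; have [Si|nSi] := pselect (S i);
    first by rewrite rhoE restr_in// hchi.
  by rewrite rhoE restr_out// (chiP i).2.2.
have Sdown m n : (m <= n)%N -> S n -> S m.
  move=> mn Sn /bV SVm; apply: Sn; apply: (Vmono _ _ mn); apply: SVm; exact: bS.
have rhoN x : N x -> rho x = 0.
  move=> Nx; apply: omega_sum_eq => i; rewrite rhochi;
    last exact: sub_socle_mod.
  by apply: (chiP i).1; exact: NV.
exists S, rho; split=> //.
(* Descent along the chain: modulo [V n], an element [x] of [V n.+1] is [b n *~ m]. If [b n] is new,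
   [chi n x = c *~ m = 0] forces [p] to divide [m], so [x] already lies in [V n]. *)
- have kerS x : Sigma x -> rho x = 0 -> N x.
    move=> Sx x0; have [n] := SV _ Sx; elim: n => [|n IH]; first by rewrite V0.
    rewrite VS => -[m Vx]; apply: IH.
    have [Vb|Sn] := pselect (V n (b n)).
      by rewrite -(subrK (b n *~ m) x); apply: subgroupD => //;
        exact: subgroupMz.
    have : chi n x = 0 by rewrite -rhochi// x0.
    rewrite -(subrK (b n *~ m) x) raddfD (chiP n).1// add0r raddfMz
      (chiP n).2.1// => cm.
    have [|||k mk] := @order_prime _ _ p_prime [set 0] c _ _ _ m cm.
    - by split=> // y z -> ->; rewrite /= subrr.
    - exact: cp.
    - exact/eqP.
    apply: subgroupD => //; rewrite mk mulrC mulrzA -pmulrn; apply: NV.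
    by apply: subgroupMz => //; case: (bS n).
  (* From the socle to [K]: the order of [x] modulo [N] is lowered by one factor [p] at a time. *)
  move=> x Kx; have [n] := pK Kx; elim: n x Kx => [|n IH] x Kx;
    first by rewrite mulr1n.
  rewrite expnSr mulrnA => Nx x0; apply: IH => //; apply: kerS.
    by split=> //; exact: subgroupMn.
  by rewrite raddfMn x0 mul0rn.
- by move=> x i nSi; rewrite rhoE restr_out.
- move=> divK.
  (* Triangular elimination from the top index: [rho (b n)] vanishes beyond [n] and equals [c] at
     [n] when [n] is in [S], so a multiple of [b n] removes the last coordinate of [f]. *)
  have soc (f : omega_sum (prufer p)) : f *+ p = 0 ->
    (forall i, ~ S i -> f i = 0) ->
      exists2 x, Sigma x & rho x = f.
    have [n] := omega_sum_bound f; elim: n f => [|n IH] f fn fp fS.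
      exists 0; first exact: subgroup0 socle_mod_subgroup.
      by rewrite raddf0; apply: omega_sum_eq => i; rewrite fn.
    have [Sn|nSn] := pselect (S n); last first.
      apply: IH => // i; rewrite leq_eqVlt => /orP[/eqP <-|];
        [exact: fS|exact: fn].
    have [m fm] : exists m, f n = c *~ m by apply: csoc;
      rewrite -omega_sumMn fp.
    have rb i : (n < i)%N -> rho (b n) i = 0.
      move=> ni; rewrite rhochi// (chiP i).1//; apply: (Vmono _ _ ni).
      by rewrite VS; exact: add_gen_gen.
    have [|||x Sx xf] := IH (f - rho (b n *~ m)).
    + move=> i; rewrite omega_sumB raddfMz omega_sumMz leq_eqVlt =>
      /orP[/eqP <-|ni].
        by rewrite rhochi// (chiP n).2.1// fm subrr.
      by rewrite rb// fn// mul0rz subr0.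
    + rewrite mulrnBl fp sub0r -(raddfMn rho) rhoN ?oppr0//.
      by rewrite pmulrn mulrzAC -pmulrn; apply: subgroupMz => //;
        exact: (bS n).2.
    + by move=> i nSi; rewrite omega_sumB fS// rhoE restr_out// subr0.
    exists (x + b n *~ m); last by rewrite raddfD xf subrK.
    have sS := socle_mod_subgroup; apply: subgroupD => //; exact: subgroupMz.
  (* Induction on the exponent that kills [f]. In the inductive step [f *+ (p ^ k)] lies in the
     socle; its preimage, divided by [p ^ k] in [K] modulo [N], gives a [y] such that [p ^ k] kills
     [f - rho y]. *)
  have tors k (f : omega_sum (prufer p)) : f *+ (p ^ k) = 0 ->
    (forall i, ~ S i -> f i = 0) ->
      exists2 x, K x & rho x = f.
    elim: k f => [|k IH] f fk fS.
      exists 0; first exact: subgroup0.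
      by rewrite raddf0 -fk.
    have [||x [Kx Nx] xf] := soc (f *+ (p ^ k)).
    - by rewrite -mulrnA -expnSr.
    - by move=> i nSi; rewrite omega_sumMn fS// mul0rn.
    have divKk j : forall x, K x -> exists2 y, K y & N (x - y *+ (p ^ j)).
      elim: j => [|j IHj] z Kz.
        by exists z; rewrite // subrr; exact: subgroup0.
      have [w Kw Nw] := IHj _ Kz; have [v Kv Nv] := divK _ Kw; exists v => //.
      rewrite expnS mulrnA -(subrKA (w *+ p ^ j)); apply: subgroupD => //.
      by rewrite -mulrnBl; exact: subgroupMn.
    have [y Ky Nxy] := divKk k x Kx.
    have [||z Kz zf] := IH (f - rho y).
    - by rewrite mulrnBl -xf -raddfMn -raddfB rhoN.
    - by move=> i nSi; rewrite omega_sumB fS// rhoE restr_out// subr0.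
    by exists (z + y); [exact: subgroupD|rewrite raddfD zf subrK].
  by move=> f fS; have [k fk] := omega_sum_prufer_torsion f; exact: tors fk fS.
- have [ST|/eqP ST] := pselect (S = setT); [by left|right].
  have [n nSn] : exists n, ~ S n.
    by apply: contrapT => H; move/eqP: ST; apply; apply/seteqP; split=> // n _;
       apply: contrapT => nSn; apply: H; exists n.
  split.
    apply: (sub_finite_set _ (finite_II n)) => i /= Si.
    by rewrite ltnNge; apply/negP => /Sdown /(_ Si).
  (* At an index outside [S] the chain has exhausted the socle, so finiteness of each [V k] modulo
     [N] bounds the socle. *)
  have Vfin k : exists L : seq M, forall x, V k x ->
    exists2 a, a \in L & N (x - a).
    elim: k => [|k [L VL]].
      by rewrite V0; exists [:: 0] => x Nx; exists 0; rewrite ?mem_head ?subr0.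
    by rewrite VS; apply: add_gen_finite VL; exact: (bS k).2.
  have [L VL] := Vfin n; exists L => x Sx; apply: VL.
  by apply: bV Sx; exact: contrapT.
Qed.

End SocleBasis.

(** * Filtered groups *)

Definition filtration (T : zmodType) (H : nat -> set T) : Prop :=
  [/\ H 0%N = setT, forall n, subgroup (H n) & forall n, H n.+1 `<=` H n].

(** Cauchy sequences in normalised form, the step from [n] to [n.+1] lying in [H n]; a general
    Cauchy sequence is reduced to this form by passing to a subsequence. *)
Definition complete_filtration (T : zmodType) (H : nat -> set T) : Prop :=
  forall x : nat -> T, (forall n, H n (x n.+1 - x n)) ->
    exists l, forall n, H n (l - x n).

Lemma filtration_le (T : zmodType) (H : nat -> set T) m n :
  filtration H -> (m <= n)%N -> H n `<=` H m.
Proof.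
move=> [_ _ HS] /subnK <-; elim: (n - m)%N => [//|k IH] x.
by rewrite addSn => /HS/IH.
Qed.

Section FiltrationCoordinates.
Context (p : nat) (p_prime : prime p) (T : zmodType) (H : nat -> set T).
Context (G : set T).
Hypotheses (fH : filtration H) (cH : complete_filtration H) (sG : subgroup G).
Hypothesis countH : forall n,
  exists e : nat -> T, forall x, exists j, H n (x - e j).
Hypothesis torsH : forall n x, exists k, H n (x *+ (p ^ k)).
Hypothesis divH : forall n x, H n x -> exists2 y, H n y & y *+ p = x.
Hypothesis closedG : forall x, (forall n, sumset G (H n) x) -> G x.

Local Notation K n := (sumset G (H n)).

(** [socle_basis] is applied to each layer [K n / K n.+1], divisible because [H n] is. Since [rho i]
    kills [K i.+1], coordinates can be prescribed one layer after another, later corrections leaving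
    the earlier ones unchanged. The subgroup [G] is the range of the embedding in the resolution,
    and 0 in the decomposition of a group itself. *)
Theorem filtration_coordinates :
  exists (S : nat -> set nat)
         (rho : nat -> {additive T -> omega_sum (prufer p)}),
  [/\ forall n x, (K n x <-> forall i, (i < n)%N -> rho i x = 0),
      forall x, (G x <-> forall i, rho i x = 0),
      forall n x i, ~ S n i -> rho n x i = 0,
      forall f : nat -> omega_sum (prufer p),
        (forall n i, ~ S n i -> f n i = 0) ->
          exists x, forall n, rho n x = f n &
      forall n, S n = setT \/
        finite_set (S n) /\ exists L : seq T,
          forall x, K n x -> K n.+1 (x *+ p) ->
            exists2 a, a \in L & K n.+1 (x - a)].
Proof.
have [H0 sH HS] := fH.
have sK n : subgroup (K n) by exact: sumset_subgroup.
have HK n : H n `<=` K n by exact: subset_sumsetr.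
have GK n : G `<=` K n by exact: subset_sumsetl.
have Kle m n : (m <= n)%N -> K n `<=` K m.
  by move=> mn x [a Ga Hxa]; exists a => //; exact: filtration_le Hxa.
have basis n : exists (S : set nat) (rho :
  {additive T -> omega_sum (prufer p)}),
  [/\ forall x, K n.+1 x -> rho x = 0,
      forall x, K n x -> rho x = 0 -> K n.+1 x,
      forall x i, ~ S i -> rho x i = 0,
      forall f : omega_sum (prufer p), (forall i, ~ S i -> f i = 0) ->
        exists2 x, K n x & rho x = f &
      S = setT \/
        finite_set S /\ exists L : seq T,
          forall x, K n x -> K n.+1 (x *+ p) ->
            exists2 a, a \in L & K n.+1 (x - a)].
  have [e eP] := countH n.+1.
  have [||x Kx|S [rho [r1 r2 r3 r4 r5]]] :=
    @socle_basis p p_prime T (K n.+1) (K n) (sK _) (sK _) _ e.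
  - exact: Kle.
  - by move=> x; have [j Hj] := eP x; exists j; exact: HK.
  - by have [k Hk] := torsH n.+1 x; exists k; exact: HK.
  exists S, rho; split=> //.
    apply: r4 => x [a Ga /divH[y Hy yE]]; exists y; first exact: HK.
    by rewrite yE opprB addrC subrK; exact: GK.
  by case: r5 => [|[fS [L LP]]];
    [left|right; split=> //; exists L => x Kx Kpx; apply: LP].
have /choice[S /choice[rho rhoP]] := basis.
have KP n x : K n x <-> forall i, (i < n)%N -> rho i x = 0.
  split=> [Kx i ni|]; first by case: (rhoP i) => r1 _ _ _ _; apply: r1;
    exact: Kle Kx.
  elim: n => [_|n IH r0]; first by apply: HK; rewrite H0.
  case: (rhoP n) => _ r2 _ _ _; apply: r2; last exact: r0.
  by apply: IH => i ni; apply: r0; exact: leqW.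
exists S, rho; split=> //.
- move=> x; split=> [Gx i|r0]; last by apply: closedG => n; apply/KP => i _.
  by apply: (KP i.+1 x).1; [exact: GK|].
- by move=> n; case: (rhoP n).
- move=> f fS.
  (* The preimage lies in [G + H n]; its part in [G] may be dropped, as [rho n] kills [G], and a
     correction inside [H n] remains. *)
  have corr n (x : T) : exists h, H n h /\ rho n (x + h) = f n.
    case: (rhoP n) => r1 r2 r3 r4 _.
    have [|y [a Ga Hy] yE] := r4 (f n - rho n x).
      by move=> i nSi; rewrite omega_sumB fS// r3// subr0.
    exists (y - a); split=> //.
    by rewrite raddfD raddfB yE (r1 a) ?subr0 1?addrC ?subrK//; exact: GK.
  have /choice[c cP] : forall u : nat * T, exists h, H u.1 h /\
    rho u.1 (u.2 + h) = f u.1.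
    by move=> [n x]; exact: corr.
  pose x := fix x n := if n is m.+1 then x m + c (m, x m) else 0.
  have [n|l lP] := cH (x := x).
    by rewrite /= addrC addKr; exact: (cP (n, x n)).1.
  exists l => n; case: (rhoP n) => r1 _ _ _ _.
  have /r1 : K n.+1 (l - x n.+1) by apply: HK.
  by rewrite raddfB => /eqP; rewrite subr_eq0 => /eqP ->;
    exact: (cP (n, x n)).2.
- by move=> n; case: (rhoP n).
Qed.

End FiltrationCoordinates.

(** * Topological groups and complete metrics *)

Lemma dependent_sequence (S : Type) (P : S -> Prop) (Q : S -> S -> Prop)
    (s0 : S) :
    P s0 -> (forall s, P s -> exists s', P s' /\ Q s s') ->
  exists u : nat -> S, u 0%N = s0 /\ forall n, P (u n) /\ Q (u n) (u n.+1).
Proof.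
move=> P0 PQ.
have /choice[f fP] : forall s, exists s', P s -> P s' /\ Q s s'.
  move=> s; have [Ps|nPs] := pselect (P s); last by exists s.
  by have [s' ?] := PQ s Ps; exists s'.
pose u := fix u n := if n is m.+1 then f (u m) else s0.
have Pu n : P (u n) by elim: n => [//|n /fP[]].
by exists u; split=> // n; split; [exact: Pu|exact: (fP _ (Pu n)).2].
Qed.

Section TopologicalGroups.
Context (T : topologicalZmodType).
Implicit Types (x y : T) (U : set T).

Lemma translate_continuous x : continuous (fun t => x + t).
Proof.
move=> t; apply: (@continuous_comp _ _ _ (fun t => (x, t)) (fun z : T * T =>
  z.1 + z.2)).
  by apply: cvg_pair => /=; [exact: cvg_cst|exact: cvg_id].
exact: add_continuous.
Qed.

Lemma nbhs_translate x y U : nbhs (x + y) U <-> nbhs y [set t | U (x + t)].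
Proof.
split=> [|nU]; first exact: translate_continuous.
have := @translate_continuous (- x) (x + y) [set t | U (x + t)].
by rewrite addKr => /(_ nU); rewrite /nbhs/=; apply: filterS => t /=;
  rewrite addNKr.
Qed.

Lemma nbhs0_translate x U : nbhs x U <-> nbhs 0 [set t | U (x + t)].
Proof. by rewrite -nbhs_translate addr0. Qed.

Lemma nbhs0_sub U : nbhs 0 U ->
  exists2 V, nbhs 0 V & forall x y, V x -> V y -> U (x - y).
Proof.
move=> nU; have := @sub_continuous T (0, 0);
  rewrite /continuous_at/= subr0 => /(_ _ nU).
move=> [[A B] /= [nA nB] AB]; exists (A `&` B); first exact: filterI.
by move=> x y [Ax _] [_ By]; apply: (AB (x, y)).
Qed.

Definition nbhs_filtration (H : nat -> set T) : Prop :=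
  [/\ filtration H, forall n, nbhs 0 (H n) &
      forall U, nbhs 0 U -> exists n, H n `<=` U].

End TopologicalGroups.

Lemma additive_continuous (T T' : topologicalZmodType)
    (h : {additive T -> T'}) :
  (forall U : set T', nbhs 0 U -> nbhs 0 (h @^-1` U)) -> continuous h.
Proof.
move=> hU x U hxU; have /nbhs0_translate nU : nbhs (h x) U := hxU.
apply/nbhs0_translate.
by apply: filterS (hU _ nU) => t; rewrite /= raddfD.
Qed.

Lemma additive_cst_continuous (T T' : topologicalZmodType)
    (h : {additive T -> T'}) (K : set T) :
  nbhs 0 K -> (forall x, K x -> h x = 0) -> continuous h.
Proof.
move=> nK hK; apply: additive_continuous => U nU.
by apply: filterS nK => x /hK /= ->; exact: nbhs_singleton.
Qed.

Lemma inv_succ_lt (R : realType) (e : R) : 0 < e -> exists n, n.+1%:R^-1 < e.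
Proof.
move=> e0; exists (Num.bound e^-1).
rewrite -[ltRHS]invrK ltf_pV2 ?posrE ?invr_gt0//.
apply: (lt_trans (archi_boundP _)); first by rewrite invr_ge0 ltW.
by rewrite ltr_nat.
Qed.

Section MetricSpaces.
Context (R : realType) (T : topologicalType) (d : T -> T -> R).
Hypotheses (md : metric_on d) (td : metrizes d) (cd : complete_metric d).

Lemma dist_ge0 x y : 0 <= d x y. Proof. by case: md. Qed.

Lemma dist_refl x : d x x = 0.
Proof. by case: md => _ + _ _; case/(_ x x) => _; apply. Qed.

Lemma dist_eq0 x y : d x y = 0 -> x = y.
Proof. by case: md => _ + _ _; case/(_ x y). Qed.

Lemma dist_sym x y : d x y = d y x. Proof. by case: md. Qed.

Lemma dist_triangle y x z : d x z <= d x y + d y z. Proof. by case: md. Qed.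

Lemma nbhs_mball x e : 0 < e -> nbhs x [set y | d x y < e].
Proof. by move=> e0; rewrite td; exists e. Qed.

Lemma mball_nbhs x U : nbhs x U ->
  exists2 e, 0 < e & [set y | d x y < e] `<=` U.
Proof. by rewrite td. Qed.

Lemma metrizes_hausdorff (x y : T) :
  (forall U V : set T, nbhs x U -> nbhs y V -> exists z, U z /\ V z) -> x = y.
Proof.
move=> xy; apply: dist_eq0; apply/eqP; rewrite eq_le dist_ge0 andbT leNgt.
apply/negP => dxy; have d2 : 0 < d x y / 2 by rewrite divr_gt0.
have [z [/= xz yz]] := xy _ _ (nbhs_mball x d2) (nbhs_mball y d2).
by have := dist_triangle z x y; rewrite (dist_sym z); lra.
Qed.

Lemma small_radius (e : nat -> R) : (forall n, 0 < e n) ->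
  (forall n, e n.+1 <= e n / 2) -> forall eps, 0 < eps -> exists n, e n < eps.
Proof.
move=> e0 eS eps eps0.
(* Halving gives the crude bound [e 0 / (n + 1)], after which the Archimedean property suffices. *)
have en n : e n * n.+1%:R <= e 0%N.
  elim: n => [|n IH]; first by rewrite mulr1.
  apply: le_trans IH; have := eS n; have := e0 n.
  rewrite -[n.+2%:R]natr1 -[n.+1%:R]natr1; have : 0 <= n%:R :> R by [].
  by nra.
exists (Num.bound (e 0%N / eps));
  rewrite -(ltr_pM2r (ltr0Sn R (Num.bound (e 0%N / eps)))).
apply: (le_lt_trans (en _)); rewrite -ltr_pdivrMl// mulrC.
apply: (lt_trans (archi_boundP _)); first by rewrite divr_ge0// ltW.
by rewrite ltr_nat.
Qed.

(** The limit is first located in the closed balls; since each closed ball lies in the preceding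
    open one, it lies in all the open balls. *)
Lemma nested_balls (x : nat -> T) (e : nat -> R) :
    (forall n, 0 < e n) -> (forall n, e n.+1 <= e n / 2) ->
    (forall n y, d (x n.+1) y <= e n.+1 -> d (x n) y < e n) ->
  exists2 l, x @ \oo --> l & forall n, d (x n) l < e n.
Proof.
move=> e0 eS nest.
have nestk n k y : d (x (n + k)%N) y <= e (n + k)%N -> d (x n) y <= e n.
  elim: k => [|k IH]; first by rewrite addn0.
  by rewrite addnS => /nest/ltW/IH.
have dx n m : (n <= m)%N -> d (x n) (x m) <= e n.
  by move=> nm; apply: (nestk n (m - n)%N); rewrite subnKC// dist_refl ltW.
have [eps eps0|l xl] := cd (u := x).
  have [N eN] := small_radius e0 eS (divr_gt0 eps0 (ltr0n R 2)).
  exists N => m n Nm Nn; apply: (le_lt_trans (dist_triangle (x N) _ _)).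
  by rewrite dist_sym; have := dx _ _ Nm; have := dx _ _ Nn; lra.
have dl n : d (x n) l <= e n.
  apply/ler_addgt0Pr => eps eps0.
  have [m [nm /= dm]] : exists m, (n <= m)%N /\ d l (x m) < eps.
    have [N _ NP] := xl _ (nbhs_mball l eps0).
    by exists (maxn n N); split; [exact: leq_maxl|apply: NP; exact: leq_maxr].
  by apply: (le_trans (dist_triangle (x m) _ _));
    rewrite lerD ?dx// ltW// dist_sym.
by exists l => // n; apply: nest.
Qed.

End MetricSpaces.

(** * Completeness of a Polish group with respect to a filtration *)

Section Klee.
Context (R : realType) (T : topologicalZmodType) (d : T -> T -> R).
Hypotheses (md : metric_on d) (td : metrizes d) (cd : complete_metric d).
Variable H : nat -> set T.
Hypothesis nH : nbhs_filtration H.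

Lemma nbhs_filtration_separated x : (forall n, H n x) -> x = 0.
Proof.
move=> Hx; apply: (metrizes_hausdorff md td) => U V nU nV.
have [_ _ HP] := nH.
have [n Hn] := HP _ nV.
exists x; split; last exact: Hn.
exact: nbhs_singleton nU.
Qed.

Lemma small_ball z e k : 0 < e ->
  exists2 k', (k <= k')%N & forall h, H k' h -> d z (z + h) < e.
Proof.
move=> e0; have [fH _ HP] := nH.
have /nbhs0_translate/HP[n Hn] := nbhs_mball td z e0.
exists (maxn k n); first exact: leq_maxl.
by move=> h /(filtration_le fH (leq_maxr _ _)) /Hn.
Qed.

(* The metric is not invariant, so a Cauchy sequence [x] for the group need not
   be [d]-Cauchy. One instead builds [y n] such that both [y n] and
   [y n + x (k n)] are [d]-Cauchy; the difference of the limits is the limit. *)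
Lemma nbhs_filtration_complete : complete_filtration H.
Proof.
move=> x xH; have [fH nHn HP] := nH; have [_ sH _] := fH.
have Hle m n : (m <= n)%N -> H n `<=` H m by move=> ?; exact: filtration_le.
have xk m n : (m <= n)%N -> H m (x n - x m).
  move=> /subnK <-; elim: (n - m)%N => [|k IH].
    by rewrite subrr; exact: subgroup0.
  rewrite -(subrKA (x (k + m)%N)); apply: subgroupD => //.
  by apply: (Hle m (k + m)%N); rewrite ?leq_addl//; exact: xH.
pose P (s : (T * nat) * (R * R)) := let: ((y, k), (e, r)) := s in
  [/\ 0 < e, 0 < r, forall h, H k h -> d y (y + h) < e &
      forall h, H k h -> d (y + x k) (y + x k + h) < r].
pose Q (s s' : (T * nat) * (R * R)) :=
  let: ((y, k), (e, r)) := s in let: ((y', k'), (e', r')) := s' in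
  [/\ (k < k')%N, e' <= e / 2, r' <= r / 2,
      forall w, d y' w <= e' -> d y w < e &
      forall w, d (y' + x k') w <= r' -> d (y + x k) w < r].
have [s0 Ps0] : exists s, P s.
  have [k1 _ k1P] := small_ball (x 0%N) 0 (ltr01 : 0 < 1 :> R).
  (* With this choice [y1 + x k2] is [x 0 + (x k2 - x k1)]. It is within 1 of [x 0], also after
     adding an element of [H k2]; hence the initial radius 2. *)
  pose y1 := x 0%N - x k1.
  have [k2 k12 k2P] := small_ball y1 k1 (ltr01 : 0 < 1 :> R).
  exists ((y1, k2), (1, 2)); split=> // h Hh.
  have zE : y1 + x k2 = x 0%N + (x k2 - x k1) by rewrite /y1 addrAC addrA.
  apply: (le_lt_trans (dist_triangle md (x 0%N) _ _)).
  have : d (x 0%N) (y1 + x k2) < 1 by rewrite zE; apply: k1P; exact: xk.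
  have : d (x 0%N) (y1 + x k2 + h) < 1.
    rewrite zE -addrA; apply: k1P; apply: subgroupD => //; first exact: xk.
    exact: Hle Hh.
  by rewrite (dist_sym md _ (x 0%N)); lra.
have step s : P s -> exists s', P s' /\ Q s s'.
  move: s => [[y k] [e r]] [e0 r0 yP zP].
  (* Both the next point [y1 + x k2] and its translates by [H k2] will be within [r / 4] of
     [y + x k]. This yields the new radius [r / 2], and a closed ball of that radius still fits into
     the old open ball. *)
  have [k1 kk1 k1P] := small_ball (y + x k) k (divr_gt0 r0 (ltr0n R 4)).
  pose y1 := y + (x k - x k1).
  have yy1 : d y y1 < e.
    by apply: yP; apply: subgroup_subC => //; exact: xk.
  pose e1 := Num.min (e / 2) ((e - d y y1) / 2).
  have e10 : 0 < e1 by rewrite lt_min !divr_gt0 ?subr_gt0.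
  have [k2 k12 k2P] := small_ball y1 k1.+1 e10.
  have zE : y1 + x k2 = y + x k + (x k2 - x k1).
    by rewrite /y1 -!addrA; congr (_ + (_ + _)); rewrite addrC.
  have zz1 : d (y + x k) (y1 + x k2) < r / 4.
    by rewrite zE; apply: k1P; apply: xk; exact: ltnW.
  exists ((y1, k2), (e1, r / 2)); split; split=> //.
  - by rewrite divr_gt0.
  - move=> h Hh; apply: (le_lt_trans (dist_triangle md (y + x k) _ _)).
    have : d (y + x k) (y1 + x k2 + h) < r / 4.
      rewrite zE -addrA; apply: k1P; apply: subgroupD => //.
        by apply: xk; exact: ltnW.
      by apply: Hle Hh; exact: ltnW.
    by rewrite (dist_sym md _ (y + x k)); lra.
  - exact: leq_ltn_trans k12.
  - by rewrite ge_min lexx.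
  - move=> w dw; apply: (le_lt_trans (dist_triangle md y1 _ _)).
    have : e1 <= (e - d y y1) / 2 by rewrite ge_min lexx orbT.
    by lra.
  - move=> w dw; apply: (le_lt_trans (dist_triangle md (y1 + x k2) _ _)).
    by lra.
have [u [_ uP]] := dependent_sequence Ps0 step.
pose y n := (u n).1.1; pose k n := (u n).1.2; pose e n := (u n).2.1;
  pose r n := (u n).2.2.
have yP n : P ((y n, k n), (e n, r n)) by have := (uP n).1; rewrite /y/k/e/r;
  case: (u n) => [[]] ? ? [].
have yQ n : Q ((y n, k n), (e n, r n)) ((y n.+1, k n.+1), (e n.+1, r n.+1)).
  by have := (uP n).2; rewrite /y/k/e/r;
    case: (u n) (u n.+1) => [[? ?] [? ?]] [[? ?] [? ?]].
have [yl yyl _] : exists2 l, y @ \oo --> l & forall n, d (y n) l < e n.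
  by apply: (nested_balls md td cd) => n;
    [case: (yP n)|case: (yQ n)|case: (yQ n)].
have [zl zzl _] : exists2 l, (fun n => y n + x (k n)) @ \oo --> l & forall n,
  d (y n + x (k n)) l < r n.
  by apply: (nested_balls md td cd) => n;
    [case: (yP n)|case: (yQ n)|case: (yQ n)].
have kn n : (n <= k n)%N.
  by elim: n => [//|n IH]; apply: leq_ltn_trans IH _; case: (yQ n).
have xl : (fun n => x (k n)) @ \oo --> zl - yl.
  have -> : (fun n => x (k n)) = (fun n => (y n + x (k n)) - y n).
    by apply/funext => n; rewrite addrC addKr.
  apply: (cvg_comp (fun n => (y n + x (k n), y n)) (fun z : T * T =>
    z.1 - z.2)).
    exact: cvg_pair zzl yyl.
  exact: (@sub_continuous T (zl, yl)).
exists (zl - yl) => n.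
have /xl[N _ NP] : nbhs (zl - yl) [set t | H n (t - (zl - yl))].
  apply/nbhs0_translate; apply: filterS (nHn n) => t /=.
  by rewrite addrC addKr.
have /= Hm := NP (maxn n N) (leq_maxr _ _).
rewrite -(subrKA (x (k (maxn n N)))); apply: subgroupD => //;
  first exact: subgroup_subC.
by apply: xk; apply: leq_trans (kn _); exact: leq_maxl.
Qed.

End Klee.

(** * The open mapping theorem for Polish groups *)

Section Baire.
Context (R : realType) (T : topologicalType) (d : T -> T -> R).
Hypotheses (md : metric_on d) (td : metrizes d) (cd : complete_metric d).

Lemma baire_closed (x0 : T) (F : nat -> set T) :
    (forall n, closed (F n)) -> (forall x, exists n, F n x) ->
  exists n (x : T), nbhs x (F n).
Proof.
move=> cF Fcov; apply: contrapT => noF.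
pose P (s : nat * (T * R)) : Prop := 0 < s.2.2.
pose Q (s s' : nat * (T * R)) := [/\ s'.1 = s.1.+1, s'.2.2 <= s.2.2 / 2,
  forall y, d s'.2.1 y <= s'.2.2 -> d s.2.1 y < s.2.2 &
  forall y, d s'.2.1 y < s'.2.2 -> ~ F s.1 y].
have step s : P s -> exists s', P s' /\ Q s s'.
  move: s => [n [x e]]; rewrite /P/= => e0.
  have [y [xy nFy]] : exists y, d x y < e /\ ~ F n y.
    apply: contrapT => H; apply: noF; exists n, x.
    apply: filterS (nbhs_mball td x e0) => y /= xy.
    by apply: contrapT => nFy; apply: H; exists y.
  have /(mball_nbhs td)[e' e'0 ye'] : nbhs y (~` F n).
    by apply: open_nbhs_nbhs; split=> //; rewrite openC.
  (* The three bounds on the radius ensure the decay, the inclusion in the previous ball and the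
     disjointness from [F n]. *)
  exists (n.+1, (y, Num.min (e / 2) (Num.min ((e - d x y) / 2) e'))).
  split; first by rewrite /P/= !lt_min !divr_gt0 ?subr_gt0.
  split=> //=; first by rewrite ge_min lexx.
    move=> z yz; apply: (le_lt_trans (dist_triangle md y _ _)).
    move: yz; rewrite !le_min => /and3P[_ yz _]; lra.
  by move=> z; rewrite !lt_min => /and3P[_ _ yz]; exact: ye'.
have P0 : P (0%N, (x0, 1)) by rewrite /P/=.
have [u [u0 uP]] := dependent_sequence P0 step.
have un n : (u n).1 = n by elim: n => [|n IH];
  [rewrite u0|case: (uP n) => _ [-> _ _ _]; rewrite IH].
have [l _ lP] : exists2 l, (fun n => (u n).2.1) @ \oo --> l & forall n,
  d (u n).2.1 l < (u n).2.2.
  by apply: (nested_balls md td cd) => n;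
    [case: (uP n)|case: (uP n) => _ []|case: (uP n) => _ []].
have [n Fl] := Fcov l; case: (uP n) => _ [_ _ _ /(_ l (lP n.+1))].
by rewrite un.
Qed.

End Baire.

Lemma dense_enum (R : realType) (T : topologicalZmodType) : polish R T ->
  exists q : nat -> T, forall (x : T) (U : set T), nbhs x U ->
    exists j, U (q j).
Proof.
move=> [[S /countable_injP[f finj] dS] _].
exists (fun j => xget 0 [set x | S x /\ f x = j]) => x U.
rewrite nbhsE => -[W [oW Wx] WU].
have [|y [Wy Sy]] := dS W _ oW; first by exists x.
exists (f y); apply: WU; case: xgetP =>
  [z _ [Sz fz]|/(_ y)/(_ (conj Sy erefl))//].
by rewrite (finj z y) ?inE.
Qed.

Section OpenMapping.
Context (R : realType) (X A : topologicalZmodType) (g : chom X A).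
Hypotheses (pX : polish R X) (pA : polish R A) (surj : forall a, exists x,
  g x = a).

(** Countably many translates [q j + V] cover [X], so by Baire the closure of the image of one of
    them has an interior point, which may be taken of the form [g (q j + v)]. Translation brings it
    to [g x], and differences of elements of [V] stay within [O] around [x]. *)
Lemma almost_open x (O : set X) : nbhs x O -> nbhs (g x) (closure (g @` O)).
Proof.
move=> /nbhs0_translate/nbhs0_sub[V nV VO].
have [q qd] := dense_enum pX; have [_ [d [md td cd]]] := pA.
pose F j := closure (g @` [set q j + v | v in V]).
have [||j [a ja]] := @baire_closed R A d md td cd 0 F.
- by move=> n; exact: closed_closure.
- move=> a; have [t <-] := surj a.
  have [|j Vj] := qd t [set y | V (t - y)].
    apply/nbhs0_translate; have [W nW WV] := nbhs0_sub nV;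
      have W0 := nbhs_singleton nW.
    apply: filterS nW => w Ww /=; rewrite opprD addrA subrr sub0r -sub0r.
    exact: WV.
  exists j; apply: subset_closure; exists t => //.
  by exists (t - q j) => //; rewrite addrC subrK.
have [_ [[_ [v Vv <-] <-] nFv]] := nbhs_singleton ja _ (nbhs_interior ja).
move: nFv => /nbhs0_translate nF; apply/nbhs0_translate;
  apply: filterS nF => t /= Ft B nB.
pose c := g x - g (q j + v).
have [_ [[_ [v' Vv' <-] <-] /= Bv']] :
  g @` [set q j + v | v in V] `&` [set y | B (c + y)] !=set0.
  apply: Ft; apply/(nbhs_translate c); rewrite /c addrA subrK.
  exact: nB.
exists (c + g (q j + v')); split=> //; exists (x + (v' - v)); first exact: VO.
rewrite /c !raddfD raddfN/= -!addrA; congr (_ + _).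
by rewrite addrCA addKr addrC.
Qed.

(* Nested balls are built around two sequences [x n] and [x' n] at once, each
   step using [almost_open] on one of them, so that [g (x n) - g (x' n)]
   converges to [a]; this avoids an invariant metric on [X]. *)
Theorem open_mapping (U : set X) : nbhs 0 U -> nbhs 0 (g @` U).
Proof.
move=> /nbhs0_sub[V nV VU]; have [_ [d [md td cd]]] := pX.
have [_ [dA [mA tA cA]]] := pA.
have [e0 e00 e0V] := mball_nbhs td nV.
pose B x e := [set y | d x y < e].
have := almost_open (nbhs_mball td 0 e00); rewrite raddf0 => nC.
apply: filterS nC => a aC.
(* Asymmetric invariant: the image of the ball around the first point accumulates at [a] plus the
   image of the second point. A step moves the first point, which exchanges the roles, then the
   second, which restores them. *)
pose P (s : (X * X) * (R * R)) := [/\ 0 < s.2.1, 0 < s.2.2 &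
  closure (g @` B s.1.1 s.2.1) (a + g s.1.2)].
pose Q (s s' : (X * X) * (R * R)) :=
  [/\ s'.2.1 <= s.2.1 / 2, s'.2.2 <= s.2.2 / 2,
  forall y, d s'.1.1 y <= s'.2.1 -> d s.1.1 y < s.2.1 &
  forall y, d s'.1.2 y <= s'.2.2 -> d s.1.2 y < s.2.2].
have shrink x y e : d x y < e -> exists e1, [/\ 0 < e1, e1 <= e / 2 &
    forall z, d y z <= e1 -> d x z < e].
  move=> xy; have xy0 := dist_ge0 md x y; exists ((e - d x y) / 2); split;
    [lra|lra|].
  by move=> z yz; apply: (le_lt_trans (dist_triangle md y _ _)); lra.
have P0 : P ((0, 0), (e0, e0)) by split=> //=; rewrite raddf0 addr0.
have step s : P s -> exists s', P s' /\ Q s s'.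
  move: s => [[x x'] [e e']] [/= ep e'p cx].
  have [_ [[x1 xx1 <-] /= cx1]] :
    g @` B x e `&` [set t | closure (g @` B x' e') (t - a)] !=set0.
    apply: cx; apply/nbhs_translate.
    have := almost_open (nbhs_mball td x' e'p); apply: filterS => t /=.
    by rewrite addrC addKr.
  have [e1 [e10 e1e e1P]] := shrink _ _ _ xx1.
  have [_ [[x1' xx1' <-] /= cx1']] :
    g @` B x' e' `&` [set s | closure (g @` B x1 e1) (a + s)] !=set0.
    apply: cx1; apply/(nbhs_translate a); rewrite addrC subrK.
    exact: almost_open (nbhs_mball td x1 e10).
  have [e1' [e1'0 e1'e e1'P]] := shrink _ _ _ xx1'.
  by exists ((x1, x1'), (e1, e1')).
have [u [u0 uP]] := dependent_sequence P0 step.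
have [l xl lP] : exists2 l, (fun n => (u n).1.1) @ \oo --> l & forall n,
  d (u n).1.1 l < (u n).2.1.
  by apply: (nested_balls md td cd) => n;
    [case: (uP n) => -[]|case: (uP n) => _ []|case: (uP n) => _ []].
have [l' xl' l'P] : exists2 l, (fun n => (u n).1.2) @ \oo --> l & forall n,
  d (u n).1.2 l < (u n).2.2.
  by apply: (nested_balls md td cd) => n;
    [case: (uP n) => -[]|case: (uP n) => _ []|case: (uP n) => _ []].
have Vl : V l by apply: e0V; have := lP 0%N; rewrite u0.
have Vl' : V l' by apply: e0V; have := l'P 0%N; rewrite u0.
exists (l - l'); first exact: VU.
rewrite raddfB; apply/eqP; rewrite subr_eq; apply/eqP.
(* For large [n], the invariant gives a point [y] in the first ball whose image lies in [A2], a
   neighbourhood of [a + g l']; the ball is then so close to [l] that [g y] also lies in [A1]. *)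
apply: (metrizes_hausdorff mA tA) => A1 A2 n1 n2.
have /(mball_nbhs td)[eps eps0 epsP] := chom_continuous n1.
have /xl'[N2 _ N2P] : nbhs l' [set y | nbhs (a + g y) A2].
  have /nbhs_translate/chom_continuous := nbhs_interior n2.
  exact.
have /xl[N1 _ N1P] := nbhs_mball td l (divr_gt0 eps0 (ltr0n R 2)).
have eS n : (u n.+1).2.1 <= (u n).2.1 / 2 by case: (uP n) => _ [].
have e_gt0 n : 0 < (u n).2.1 by case: (uP n) => -[].
have [n' en'] := small_radius e_gt0 eS (divr_gt0 eps0 (ltr0n R 2)).
have ele k : (u (n' + k)%N).2.1 <= (u n').2.1.
  elim: k => [|k IH]; first by rewrite addn0.
  by rewrite addnS; have := eS (n' + k)%N; have := e_gt0 (n' + k)%N; lra.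
pose n := (n' + (N1 + N2))%N.
have /N1P/= ln : (N1 <= n)%N by rewrite /n addnCA leq_addr.
have /N2P/= an : (N2 <= n)%N by rewrite /n addnA leq_addl.
have [_ _ /(_ _ an)[_ [[y /= ny <-] A2y]]] := (uP n).1.
exists (g y); split=> //; apply: epsP => /=.
have := dist_triangle md (u n).1.1 l y; have := ele (N1 + N2)%N; rewrite -/n.
by move: en' ny ln; rewrite /B/=; lra.
Qed.

End OpenMapping.

(** * Groups with a basis of open subgroups *)

Section ChomTheory.
Context (A B : topologicalZmodType) (f : chom A B).

Lemma chom0 : f 0 = 0. Proof. exact: raddf0. Qed.

Lemma chomB x y : f (x - y) = f x - f y. Proof. exact: raddfB. Qed.

Lemma chomD x y : f (x + y) = f x + f y. Proof. exact: raddfD. Qed.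

Lemma chomN x : f (- x) = - f x. Proof. exact: raddfN. Qed.

Lemma chomMn x n : f (x *+ n) = f x *+ n. Proof. exact: raddfMn. Qed.

Lemma chom_nbhs0 (U : set B) : nbhs 0 U -> nbhs 0 (f @^-1` U).
Proof. by move=> nU; apply: (chom_continuous (x := 0)); rewrite chom0. Qed.

End ChomTheory.

Lemma chom_subE (A B : topologicalZmodType)
  (f g : chom A B) x : (f - g) x = f x - g x.
Proof. by []. Qed.

Lemma chom_of_additive (A B : topologicalZmodType) (h : {additive A -> B}) :
  continuous h -> exists f : chom A B, forall x, f x = h x.
Proof.
move=> ch; have hP : (h : A -> B) \in is_chom A B.
  by apply/asboolP; split=> // x y; exact: raddfB.
by exists (Chom hP).
Qed.

Definition linear_topology (T : topologicalZmodType) : Prop :=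
  forall U : set T, nbhs 0 U ->
    exists K : set T, [/\ subgroup K, nbhs 0 K & K `<=` U].

Lemma homeo_nbhs0 (A B : topologicalZmodType) (f : chom A B) (K : set A) :
    homeo_onto_range f -> nbhs 0 K ->
  exists2 V : set B, nbhs 0 V & forall a, V (f a) -> K a.
Proof.
move=> [finj cf fo]; rewrite nbhsE => -[W [oW W0] WK].
have [V oV VE] := fo W oW.
have fV : V (f 0).
  have : (f @` W) (f 0) by exists 0.
  by rewrite VE => -[].
exists V; first by apply: open_nbhs_nbhs; split=> //; rewrite -(chom0 f).
move=> a Va; apply: WK; have : (V `&` range f) (f a) by split=> //; exists a.
by rewrite -VE => -[a' Wa' /finj <-].
Qed.

(** An open subgroup is built as [N0 + f H], where [N0] is the part of a small neighbourhood [N]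
    above an open subgroup [B] of [A] contained in [g @ N], the image of [N]. *)
Lemma linear_topology_extension (G X A : topologicalZmodType) (f : chom G X)
  (g : chom X A) :
    homeo_onto_range f -> (forall x, g x = 0 -> exists y, f y = x) ->
    (forall y, g (f y) = 0) ->
    (forall U : set X, nbhs 0 U -> nbhs 0 (g @` U)) ->
    linear_topology G -> linear_topology A ->
  linear_topology X.
Proof.
move=> hf exact_gf gf og lG lA W nW.
have [W1 nW1 W1W] := nbhs0_sub nW.
have nfW1 : nbhs 0 (f @^-1` W1).
  exact: chom_nbhs0.
have [H [sH nH HW1]] := lG _ nfW1.
have [V nV VH] := homeo_nbhs0 hf nH.
have [E1 nE1 E1V] := nbhs0_sub nV.
have [E2 nE2 E2E1] := nbhs0_sub nE1.
pose N := E1 `&` E2 `&` W1.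
have nN : nbhs 0 N by apply: filterI => //; exact: filterI.
have [B [sB nB BN]] := lA _ (og _ nN).
pose N0 := N `&` g @^-1` B.
have nN0 : nbhs 0 N0.
  by apply: filterI => //; apply: (chom_continuous (x := 0)); rewrite chom0.
exists [set x | exists v h, [/\ N0 v, H h & x = v + f h]]; split.
- split; first by exists 0, 0; rewrite chom0 addr0; split=> //;
    [exact: nbhs_singleton nN0|exact: subgroup0].
  move=> _ _ [v [h [[[[E1v E2v] W1v] Bv] Hh ->]]]
    [v' [h' [[[[E1v' E2v'] W1v'] Bv'] Hh' ->]]].
  (* A difference of two elements of [N0] maps into [B], so some [w] in [N] has the same image. The
     defect comes from [G], and it is so small, by the choice of [E1] and [E2], that it comes from
     [H]. *)
  have [w Nw gw] : (g @` N) (g (v - v')).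
    by apply: BN; rewrite chomB; exact: subgroupB.
  have [h'' h''E] : exists y, f y = v - v' - w.
    by apply: exact_gf; rewrite chomB gw subrr.
  have Hh'' : H h''.
    by apply: VH; rewrite h''E; apply: E1V; [exact: E2E1|case: Nw => -[]].
  exists w, (h'' + (h - h')); split.
  + by split=> //=; rewrite gw chomB; exact: subgroupB.
  + by apply: subgroupD => //; exact: subgroupB.
  + rewrite chomD h''E chomB addrA [w + _]addrC subrK opprD.
    by rewrite addrACA.
- by apply: filterS nN0 => v N0v; exists v, 0; rewrite chom0 addr0; split=> //;
  exact: subgroup0.
- move=> _ [v [h [[[_ W1v] _] Hh ->]]].
  rewrite -[f h]opprK -chomN; apply: W1W => //; apply: HW1.
  exact: subgroupN.
Qed.

Lemma chom_factor (B C I : topologicalZmodType) (g : chom B C) (h : chom B I) :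
    (forall c, exists b, g b = c) ->
    (forall U : set B, nbhs 0 U -> nbhs 0 (g @` U)) ->
    (forall b, g b = 0 -> h b = 0) ->
  exists k : chom C I, forall b, k (g b) = h b.
Proof.
move=> surj og gh; have /choice[s sP] := surj.
have hs b : h (s (g b)) = h b.
  apply/eqP; rewrite -subr_eq0 -chomB; apply/eqP/gh.
  by rewrite chomB sP subrr.
have kB : zmod_morphism (h \o s).
  move=> x y /=; rewrite -chomB; have [a <-] := surj x; have [b <-] := surj y.
  by rewrite -chomB hs !chomB !hs.
have [k kE] := zmod_morphism_additive kB.
have ck : continuous k.
  apply: additive_continuous => U nU.
  have nhU : nbhs 0 (h @^-1` U).
    exact: chom_nbhs0.
  by apply: filterS (og _ nhU) => _ [b Ub <-]; rewrite kE /= hs.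
have [k' k'E] := chom_of_additive ck.
by exists k' => b; rewrite k'E kE /= hs.
Qed.

(** One notion for two purposes: it applies to short exact sequences of pro-p groups and to the
    extensions of the Ext condition, whose middle term is only shown to have a basis of open
    subgroups. *)
Definition linear_injective (I : topologicalZmodType) : Prop :=
  forall (A B : topologicalZmodType) (f : chom A B),
    linear_topology B -> homeo_onto_range f ->
  forall phi : chom A I, exists psi : chom B I, forall x, psi (f x) = phi x.

(** The kernel of [phi] is open, so it contains the preimage of an open subgroup [U] of [B]. Then
    [phi] on the range of [f] and 0 on [U] are compatible; divisibility extends them to [B], and
    vanishing on [U] makes the extension continuous. *)
Lemma linear_injective_discrete (D : zmodType) :
  divisible [set: D] -> linear_injective (discrete_topology D).
Proof.
move=> divD A B f lB hf phi.
have nK : nbhs 0 (phi @^-1` [set 0]).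
  apply: (chom_continuous (x := 0)); rewrite chom0.
  exact: discrete_set1.
have [V nV VK] := homeo_nbhs0 hf nK.
have [U [sU nU UV]] := lB _ nV.
pose Gamma : set (B * discrete_topology D) :=
  [set u | exists a, U (u.1 - f a) /\ u.2 = phi a].
have [|h hP] := @partial_hom_extension B (discrete_topology D) divD Gamma.
  split.
  - exists 0; rewrite /= !chom0 subrr; split=> //; exact: subgroup0.
  - move=> x y x' y' [a [/= Ua ->]] [a' [/= Ua' ->]]; exists (a - a').
    by rewrite /= !chomB subrACA; split=> //; exact: subgroupB.
  - move=> d [a [/= Ua ->]]; apply: VK; apply: UV.
    by have := subgroupN sU Ua; rewrite sub0r opprK.
have ch : continuous h.
  apply: (additive_cst_continuous nU) => x Ux; apply: hP; exists 0.
  by rewrite /= !chom0 subr0.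
have [psi psiE] := chom_of_additive ch.
exists psi => x; rewrite psiE; apply: hP; exists x.
by rewrite /= subrr; split=> //; exact: subgroup0.
Qed.

Section Powers.
Context (I : Type) (A : topologicalZmodType).

Lemma ptws_proj_nbhs (h : {ptws I -> A}) (i : I) (V : set A) :
  nbhs (h i) V -> nbhs h [set k : {ptws I -> A} | V (k i)].
Proof.
move=> hV; have /cvg_sup/(_ i) hi : nbhs h --> h by exact: cvg_id.
apply: (hi [set k : {ptws I -> A} | V (k i)]).
exact: (@initial_continuous _ A (fun k : {ptws I -> A} => k i) h V hV).
Qed.

Lemma ptws_cvg (F : set_system {ptws I -> A}) (h : {ptws I -> A}) : Filter F ->
  (forall i (V : set A), nbhs (h i) V -> F [set k : {ptws I -> A} | V (k i)]) ->
    F --> h.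
Proof.
move=> FF FV; apply/cvg_sup => i U [_ [[W oW <-] /= Whi WU]].
apply: filterS WU _; apply: FV; exact: open_nbhs_nbhs.
Qed.

Lemma ptws_chom (B : topologicalZmodType) (h : I -> chom B A) :
  exists k : chom B {ptws I -> A}, forall b i, k b i = h i b.
Proof.
pose k0 (b : B) : {ptws I -> A} := fun i => h i b.
have kB : zmod_morphism k0 by move=> x y; apply/funext => i; exact: raddfB.
have [k1 k1E] := zmod_morphism_additive kB.
have ck : continuous k1.
  move=> b; apply: ptws_cvg => i V; rewrite k1E => /chom_continuous; exact.
have [k kE] := chom_of_additive ck.
by exists k => b i; rewrite kE k1E.
Qed.

Lemma ptws_proj (i : I) : exists k : chom {ptws I -> A} A, forall f, k f = f i.
Proof.
have kB : zmod_morphism (fun f : {ptws I -> A} => f i) by [].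
have [k1 k1E] := zmod_morphism_additive kB.
have ck : continuous k1.
  by rewrite k1E => f V; exact: ptws_proj_nbhs.
have [k kE] := chom_of_additive ck.
by exists k => f; rewrite kE k1E.
Qed.

Lemma linear_injective_ptws : linear_injective A ->
  linear_injective {ptws I -> A}.
Proof.
move=> iA B C f lC hf phi.
have /choice[psi psiP] : forall i, exists psi : chom C A, forall x,
  psi (f x) = phi x i.
  move=> i; have [pi piE] := ptws_proj i.
  have [|q qE] := @chom_of_additive B A (pi \o phi).
    by move=> x; apply: continuous_comp; exact: chom_continuous.
  have [psi psiE] := iA _ _ _ lC hf q.
  by exists psi => x; rewrite psiE qE /= piE.
have [k kE] := ptws_chom psi.
by exists k => x; apply/funext => i; rewrite kE.
Qed.

End Powers.

Lemma chom_comp (A B C : topologicalZmodType) (g : chom B C) (f : chom A B) :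
  exists k : chom A C, forall x, k x = g (f x).
Proof.
have [|k kE] := @chom_of_additive A C (g \o f).
  by move=> x; apply: continuous_comp; exact: chom_continuous.
by exists k => x; rewrite kE.
Qed.

Section DirectSums.
Context (A B : topologicalZmodType).

Lemma tdsum_fst : exists q : chom (tdsum A B) A, forall z, q z = z.1.
Proof.
have [|q0 q0E] := @zmod_morphism_additive (tdsum A B) A (fun z => z.1);
  first by [].
have [|q qE] := @chom_of_additive _ _ q0.
  by rewrite q0E => z; exact: (@cvg_fst A B).
by exists q => z; rewrite qE q0E.
Qed.

Lemma tdsum_snd : exists q : chom (tdsum A B) B, forall z, q z = z.2.
Proof.
have [|q0 q0E] := @zmod_morphism_additive (tdsum A B) B (fun z => z.2);
  first by [].
have [|q qE] := @chom_of_additive _ _ q0.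
  by rewrite q0E => z; exact: (@cvg_snd A B).
by exists q => z; rewrite qE q0E.
Qed.

Lemma tdsum_pair (C : topologicalZmodType) (f : chom C A) (g : chom C B) :
  exists k : chom C (tdsum A B), forall x, k x = (f x, g x).
Proof.
have [|k0 k0E] := @zmod_morphism_additive C (tdsum A B) (fun x => (f x, g x)).
  by move=> x y; rewrite !chomB.
have [|k kE] := @chom_of_additive _ _ k0.
  by rewrite k0E => x; apply: cvg_pair; exact: chom_continuous.
by exists k => x; rewrite kE k0E.
Qed.

End DirectSums.

Lemma linear_injective_tdsum (I J : topologicalZmodType) :
  linear_injective I -> linear_injective J -> linear_injective (tdsum I J).
Proof.
move=> iI iJ B C f lC hf phi.
have [p1 p1E] := tdsum_fst I J; have [p2 p2E] := tdsum_snd I J.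
have [q1 q1E] := chom_comp p1 phi; have [q2 q2E] := chom_comp p2 phi.
have [r1 r1E] := iI _ _ _ lC hf q1; have [r2 r2E] := iJ _ _ _ lC hf q2.
have [k kE] := tdsum_pair r1 r2.
exists k => x; rewrite kE r1E r2E q1E q2E p1E p2E.
by case: (phi x).
Qed.

Lemma linear_injective_retract (I J : topologicalZmodType) (s : chom I J)
  (r : chom J I) :
  cancel s r -> linear_injective J -> linear_injective I.
Proof.
move=> sr iJ A B f lB hf phi.
have [q qE] := chom_comp s phi.
have [psi psiE] := iJ _ _ _ lB hf q.
have [k kE] := chom_comp r psi.
by exists k => x; rewrite kE psiE qE sr.
Qed.

(** * Complete filtrations and Polish topologies *)

Section PolishFiltration.
Context (R : realType) (T : topologicalZmodType) (H : nat -> set T).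
Hypotheses (nH : nbhs_filtration H) (cH : complete_filtration H).
Hypothesis sepH : forall x, (forall n, H n x) -> x = 0.
Hypothesis countH : forall n, exists e : nat ->
  T, forall x, exists j, H n (x - e j).

(* [d x y] is [1 / (n + 1)] for the least [n] with [~ H n (x - y)]. *)
Let invS n : R := n.+1%:R^-1.
Let E x y : set R := [set 0] `|` [set invS n | n in [set n | ~ H n (x - y)]].
Let d x y : R := sup (E x y).

Let fH : filtration H. Proof. by case: nH. Qed.
Let sH n : subgroup (H n). Proof. by case: fH. Qed.

Let invS_gt0 n : 0 < invS n. Proof. by rewrite invr_gt0. Qed.

Let invS_le m n : (m <= n)%N -> invS n <= invS m.
Proof. by move=> mn; rewrite lef_pV2 ?posrE// ler_nat. Qed.

Let invS_lt n : invS n.+1 < invS n.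
Proof. by rewrite ltf_pV2 ?posrE// ltr_nat. Qed.

Let has_supE x y : has_sup (E x y).
Proof.
split; first by exists 0; left.
exists 1 => _ [->//|[n _ <-]].
by rewrite -[leRHS]invr1 lef_pV2 ?posrE// ler1n.
Qed.

Let d_ge0 x y : 0 <= d x y.
Proof. by apply: ub_le_sup; [case: (has_supE x y)|left]. Qed.

Let d_le x y r : 0 <= r -> (forall n, ~ H n (x - y) -> invS n <= r) ->
  d x y <= r.
Proof.
move=> r0 hr; apply: ge_sup; first by case: (has_supE x y).
by move=> _ [->//|[n /= nHn <-]]; exact: hr.
Qed.

Let d_ge x y n : ~ H n (x - y) -> invS n <= d x y.
Proof. by move=> nHn; apply: ub_le_sup;
  [case: (has_supE x y)|right; exists n]. Qed.

(** Open balls of radius [1 / (n + 1)] are exactly the cosets of [H n]; every property of [d] below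
    is read off from this. *)
Let d_lt x y n : d x y < invS n <-> H n (x - y).
Proof.
split=> [|Hn]; first by apply: contraPP => /d_ge; rewrite leNgt => /negP.
apply: le_lt_trans (invS_lt n); apply: d_le => [|m nHm]; first exact: ltW.
apply: invS_le; rewrite ltnNge; apply/negP => mn; apply: nHm.
exact: filtration_le Hn.
Qed.

Let d_metric : metric_on d.
Proof.
split=> //.
- move=> x y; split=> [dxy|->].
    apply/eqP; rewrite -subr_eq0; apply/eqP/sepH => n; apply/d_lt.
    by rewrite dxy.
  apply/eqP; rewrite eq_le d_ge0 andbT; apply: d_le => // n.
  by rewrite subrr => /(_ (subgroup0 (sH n))).
- have sym x y : d x y <= d y x.
    apply: d_le => // n nHn; apply: d_ge => Hn; apply: nHn.
    exact: subgroup_subC.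
  by move=> x y; apply/eqP; rewrite eq_le !sym.
- move=> x y z; apply: d_le => [|n nHn]; first exact: addr_ge0.
  have [Hxy|] := pselect (H n (x - y)); last first.
    by move=> /d_ge/le_trans; apply; rewrite lerDl.
  have [Hyz|] := pselect (H n (y - z)); last first.
    by move=> /d_ge/le_trans; apply; rewrite lerDr.
  by exfalso; apply: nHn; rewrite -(subrKA y); exact: subgroupD.
Qed.

Let d_metrizes : metrizes d.
Proof.
have [_ nHn HP] := nH.
move=> x; apply/seteqP; split=> U.
  move=> /nbhs0_translate/HP[n HU]; exists (invS n); first exact: invS_gt0.
  move=> y /= /d_lt Hn.
  by rewrite -(subrK x y) addrC; apply: HU; exact: subgroup_subC.
move=> [e /= /inv_succ_lt[n ne] eU]; apply/nbhs0_translate.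
apply: filterS (nHn n) => t Ht /=; apply: eU => /=.
by apply: (lt_trans _ ne); apply/d_lt; rewrite opprD addrA subrr sub0r;
  exact: subgroupN.
Qed.

Let d_complete : complete_metric d.
Proof.
move=> u uC.
have /choice[N NP] : forall n, exists N, forall m m', (N <= m)%N ->
  (N <= m')%N -> H n (u m - u m').
  by move=> n; have [N NP] := uC _ (invS_gt0 n); exists N => m m' Nm Nm';
    apply/d_lt; exact: NP.
(* A sum, so that [M n] is at least [N m] for every [m <= n]; this puts the subsequence [u (M n)] in
   normalised form. *)
pose M n := (\sum_(i < n.+1) N i)%N.
have NM n m : (n <= m)%N -> (N n <= M m)%N.
  by move=> nm; rewrite /M (bigD1 (Ordinal (nm : (n < m.+1)%N)))//= leq_addr.
have [n|l lP] := cH (x := fun n => u (M n)); first by apply: NP; exact: NM.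
exists l => U /nbhs0_translate nU; have [_ _ /(_ _ nU)[n HU]] := nH.
exists (M n) => // m /= Mm.
rewrite -(subrK l (u m)) addrC; apply: HU.
rewrite -(subrKA (u (M n))); apply: subgroupD => //.
  by apply: NP; [exact: leq_trans (NM _ _ _) Mm|exact: NM].
exact: subgroup_subC.
Qed.

Theorem polish_of_filtration : polish R T.
Proof.
split; last by exists d; split.
have /choice[e eP] := countH.
exists [set e u.1 u.2 | u in [set: nat * nat]].
  exact: sub_countable (card_image_le _ _) (countableP _).
move=> U [x Ux] oU.
have /nbhs0_translate nU : nbhs x U by exact: open_nbhs_nbhs.
have [_ _ /(_ _ nU)[n HU]] := nH; have [j Hj] := eP n x.
exists (e n j); split; last by exists (n, j).
by rewrite -(subrK x (e n j)) addrC; apply: HU; exact: subgroup_subC.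
Qed.

End PolishFiltration.

(** * Countable powers of a discrete group, filtered by tails *)

Section DiscretePower.
Context (D : zmodType).
Local Notation A := {ptws nat -> discrete_topology D}.

Definition tail (n : nat) : set A :=
  [set f : A | forall i, (i < n)%N -> f i = 0].

Lemma discrete_powerMn (f : A) m i : (f *+ m) i = (f i : D) *+ m.
Proof. by elim: m => [//|m IH]; rewrite !mulrS -IH. Qed.

Lemma tail_subgroup n : subgroup (tail n).
Proof.
split=> [//|f g fn gn i ni].
by rewrite -[(f - g) i]/(f i - g i) fn// gn// subrr.
Qed.

Lemma tail_nbhs_filtration : nbhs_filtration tail.
Proof.
split.
- split=> [|n|n f fn i ni]; [|exact: tail_subgroup|by apply: fn; exact: leqW].
  by apply/seteqP; split.
- elim=> [|n IH]; first by apply: filterS filterT.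
  have := @ptws_proj_nbhs nat (discrete_topology D) 0 n [set 0]
    (discrete_set1 _).
  move=> n0; apply: filterS (filterI IH n0) => f [fn /= f0] i.
  by rewrite ltnS leq_eqVlt => /orP[/eqP->|/fn].
(* The filter generated by the tails converges to 0 in each coordinate, hence in the power, so [U]
   belongs to it. *)
- move=> U nU; pose F : set_system A :=
  [set V : set A | exists n, tail n `<=` V].
  have FF : Filter F.
    split; first by exists 0.
      move=> V W [n nV] [m mW]; exists (maxn n m) => f fnm; split.
        by apply: nV => i ni; apply: fnm; rewrite leq_max ni.
      by apply: mW => i ni; apply: fnm; rewrite leq_max ni orbT.
    by move=> V W VW [n nV]; exists n => f /nV /VW.
  have : F --> (0 : A).
    apply: ptws_cvg => i V /nbhs_singleton V0; exists i.+1 => f fi /=.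
    by rewrite fi.
  exact.
Qed.

Lemma tail_complete : complete_filtration tail.
Proof.
(* Coordinate [i] of [x n] no longer changes from [n = i.+1] on, so the limit is read along this
   shifted diagonal. *)
move=> x xn; exists (fun i => x i.+1 i) => n i ni.
rewrite -[LHS]/(x i.+1 i - x n i).
have : forall k, x (i.+1 + k)%N i = x i.+1 i.
  elim=> [|k IH]; first by rewrite addn0.
  have := xn (i.+1 + k)%N i; rewrite leq_addr => /(_ isT) /eqP.
  by rewrite -[X in X == _]/(x _ i - x _ i) subr_eq0 -addnS => /eqP ->.
by move=> /(_ (n - i.+1)%N); rewrite subnKC// => ->; rewrite subrr.
Qed.

Lemma tail_separated f : (forall n, tail n f) -> f = 0.
Proof. by move=> fn; apply/funext => i; exact: (fn i.+1). Qed.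

Lemma tail_countable : countable [set: D] ->
  forall n, exists e : nat -> A, forall x, exists j, tail n (x - e j).
Proof.
move=> /countable_enum[c cP]; elim=> [|n [e eP]];
  first by exists (fun=> 0) => x; exists 0%N => i.
pose single (a : D) : A := fun i => if i == n then a else 0.
exists (fun k => if unpickle k is Some (j, l) then e j + single (c l) else 0) =>
  x.
have [j ej] := eP x; have [l cl] := cP ((x - e j) n : D).
exists (pickle (j, l)); rewrite pickleK => i.
rewrite -[LHS]/((x i - (e j i + single (c l) i) : D)) opprD addrA.
rewrite ltnS leq_eqVlt /single => /orP[/eqP ->|ni].
  by rewrite eqxx cl subrr.
rewrite ltn_eqF// subr0; exact: (ej i ni).
Qed.

Lemma tail_divisible : divisible [set: D] -> forall n, divisible (tail n).
Proof.
move=> divD n k f k0 fn.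
have /choice[g gP] : forall x : D, exists y, y *+ k = x /\ (x = 0 -> y = 0).
  move=> x; have [->|x0] := eqVneq x 0; first by exists 0; rewrite mul0rn.
  have [y _ yx] := divD k x k0 I.
  by exists y; split=> // x0'; rewrite x0' eqxx in x0.
exists (fun i => g (f i)) => [i ni|]; first by apply: (gP _).2; exact: fn.
by apply/funext => i; rewrite discrete_powerMn (gP (f i)).1.
Qed.

Lemma tail_torsion p : (forall x : D, exists k, x *+ (p ^ k) = 0) ->
  forall n (f : A), exists k, tail n (f *+ (p ^ k)).
Proof.
move=> torsD n f; have /choice[k kP] := torsD.
exists (\sum_(i < n) k (f i))%N => i ni.
by rewrite discrete_powerMn (bigD1 (Ordinal ni))//= expnD mulrnA kP mul0rn.
Qed.

Lemma polish_discrete_power (R : realType) : countable [set: D] -> polish R A.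
Proof.
move=> cD; apply: (polish_of_filtration R tail_nbhs_filtration tail_complete).
  exact: tail_separated.
exact: tail_countable.
Qed.

End DiscretePower.

(** * Quotients, Lie groups and pro-p groups *)

Section QuotientMap.
Context (G : topologicalZmodType) (N : zmodClosed G).

Let pi (x : G) : tquot N := \pi_(Quotient.quot N) x.

Lemma tproj_exists : exists f : chom G (tquot N),
  [/\ forall u, exists x, f x = u, forall x, f x = 0 <-> x \in N &
      forall U : set G, nbhs 0 U -> nbhs 0 (f @` U)].
Proof.
have piB : zmod_morphism pi by move=> x y; exact: raddfB.
have [h hE] := zmod_morphism_additive piB.
have [|f fE'] := @chom_of_additive _ _ h.
  by rewrite hE; exact: (@pi_continuous G (Quotient.quot N)).
have fE x : f x = pi x by rewrite fE' hE.
have piE x : f x = 0 <-> x \in N.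
  rewrite fE; have /= E := Quotient.idealrBE N x 0; rewrite subr0 in E.
  have -> : 0 = pi 0 by rewrite -hE raddf0.
  by rewrite E; split=> [H|/eqP H]; [apply/eqP; exact: H|exact: H].
exists f; split=> //.
- by move=> u; exists (repr (u : Quotient.quot N)); rewrite fE; exact: reprK.
- move=> U nU; rewrite nbhsE; exists (f @` U°); last first.
    by move=> _ [x /nbhs_singleton Ux <-]; exists x.
  split; last by exists 0; [exact: nbhs_singleton (nbhs_interior nU)|exact:
    chom0].
  rewrite /open/= /quotient_open.
  have -> : \pi_(quotient_topology (Quotient.quot N)) @^-1` (f @` U°) = f @^-1`
    (f @` U°).
    by apply/seteqP; split=> x /=; rewrite fE.
  rewrite openE => x [w Uw wx]; apply/nbhs0_translate.
  have /nbhs0_translate := open_nbhs_nbhs (conj (@open_interior _ U) Uw).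
  apply: filterS => t Ut /=; exists (w + t) => //.
  by rewrite !chomD wx.
Qed.

End QuotientMap.

Section DiscreteLie.
Context (R : realType) (T : topologicalZmodType).
Hypotheses (dT : nbhs 0 [set (0 : T)]) (cT : countable [set: T]).

Lemma discrete_nbhs (x : T) (U : set T) : nbhs x U <-> U x.
Proof.
split=> [/nbhs_singleton//|Ux]; apply/nbhs0_translate.
by apply: filterS dT => t ->; rewrite /= addr0.
Qed.

Lemma discrete_polish : polish R T.
Proof.
(* The filtration [T], 0, 0, ... reduces the claim to [polish_of_filtration]: a normalised sequence
   is constant from index 1 on. *)
pose H n : set T := if n is 0 then setT else [set 0].
have sH n : subgroup (H n) by case: n => [//|n]; split=> // x y -> ->;
  rewrite /= subrr.
have nH : nbhs_filtration H.
  split.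
  - by split=> // -[|n] x.
  - by case=> [|n]; [exact: filterT|].
  - by move=> U /nbhs_singleton U0; exists 1%N => x ->.
have [e eP] := countable_enum cT.
apply: (polish_of_filtration R nH).
- move=> x xH; exists (x 1%N) => -[//|n]; rewrite /=.
  elim: n => [|n IH]; first by rewrite subrr.
  have := xH n.+1; rewrite /= => /eqP; rewrite subr_eq0 => /eqP ->.
  exact: IH.
- by move=> x /(_ 1%N).
- by move=> n; exists e => x; have [j <-] := eP x; exists j; rewrite subrr;
  exact: subgroup0.
Qed.

Lemma discrete_lie : abelian_polish_lie R T.
Proof.
split; first exact: discrete_polish.
exists 0%N, 0%N, T; split=> //.
have [|i0 i0E] := @zmod_morphism_additive T (discrete_topology T) id.
  by [].
have [|i iE] := @chom_of_additive _ _ i0.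
  by apply: (additive_cst_continuous dT) => x ->; rewrite raddf0.
have [f fE] := tdsum_pair (0 :
  chom T (tdsum {ptws 'I_0 -> R} {ptws 'I_0 -> circle R})) i.
have [|j0 j0E] := @zmod_morphism_additive (discrete_topology T) T id.
  by [].
have [|j jE] := @chom_of_additive _ _ j0.
  apply: (@additive_cst_continuous _ _ _ [set 0]); first exact: discrete_set1.
  by move=> x ->; rewrite raddf0.
have [s sE] := @tdsum_snd (tdsum {ptws 'I_0 -> R} {ptws 'I_0 -> circle R})
  (discrete_topology T).
have [g gE] := chom_comp j s.
exists f, g; split=> x.
  by rewrite gE sE fE jE j0E iE i0E.
rewrite fE gE iE i0E jE j0E sE; case: x => [[a b] c] /=.
congr (_, _); congr (_, _); by apply/funext => -[].
Qed.

Lemma discrete_pgroup p : (forall x : T, exists n, x *+ (p ^ n) = 0) ->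
  topological_pgroup R p T.
Proof.
move=> tT; split; first exact: discrete_polish.
- move=> x _; exists [set x]; first exact/discrete_nbhs.
  split; first exact: compact_set1.
  move=> y /(_ [set y] ((discrete_nbhs y _).2 erefl)) [_ [-> ->]] //.
- move=> x U /nbhs_singleton U0; have [n xn] := tT x.
  exists n => // m /= nm; rewrite -(subnK nm) addnC expnD mulrnA xn mul0rn.
  exact: U0.
Qed.

End DiscreteLie.

(** * Lie groups whose elements are topologically p-torsion are discrete *)

Section LieDiscrete.
Context (R : realType) (p : nat) (p_prime : prime p).

Definition p_torsion_like (T : topologicalZmodType) : Prop :=
  forall x : T, x *+ (p ^ n) @[n --> \oo] --> (0 : T).

Lemma p_torsion_like_image (A B : topologicalZmodType) (f : chom A B) :
  (forall b, exists a, f a = b) -> p_torsion_like A -> p_torsion_like B.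
Proof.
move=> surj pA b U nU; have [a <-] := surj b.
have [N _ NP] := pA a _ (chom_nbhs0 f nU).
by exists N => // n /NP /=; rewrite chomMn.
Qed.

Lemma real_not_p_torsion_like : ~ p_torsion_like R.
Proof.
move=> /(_ 1) /(_ (ball (0 : R) 1)) [|N _ NP]; first exact: nbhsx_ballx.
have /= := NP N (leqnn N); rewrite /ball/= sub0r normrN normr_nat ltrn1.
rewrite ltnS leqn0 expn_eq0 => /andP[/eqP p0] _.
by have := prime_gt0 p_prime; rewrite p0.
Qed.

(* Multiplication by [p] sends the class of [1 / (p + 1)] to its opposite. *)
Lemma circle_not_p_torsion_like : ~ p_torsion_like (circle R).
Proof.
have [q [_ qE qo]] := tproj_exists (int_subgroup R).
pose r : R := p.+1%:R^-1.
have r0 : 0 < r by rewrite invr_gt0.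
have r1 : p.+1%:R * r = 1 by rewrite divff// pnatr_eq0.
have r2 : r + r < 1.
  by rewrite -mulr2n -mulr_natl -[ltRHS]r1 ltr_pM2r// ltr_nat ltnS prime_gt1.
have sgn n : q r *+ (p ^ n) = q r \/ q r *+ (p ^ n) = - q r.
  have qp : q r *+ p = - q r.
    apply/eqP; rewrite -subr_eq0 opprK -mulrSr -chomMn; apply/eqP/qE.
    by rewrite -mulr_natl r1 -[_ \in _]/(1 \is a Num.int) int_num1.
  elim: n => [|n [IH|IH]]; first by left.
    by right; rewrite expnSr mulrnA IH.
  by left; rewrite expnSr mulrnA IH mulNrn qp opprK.
move=> /(_ (q r)) /(_ (q @` ball (0 : R) r)) [|N _ NP].
  by apply: qo; exact: nbhsx_ballx.
have [t] := NP N (leqnn N).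
rewrite /ball/= sub0r normrN => tr qt.
(* Here [s] is [r] or [- r]. Then [t] and [s] differ by an integer of absolute value less than
   [r + r < 1], so they are equal, against [t] being in the open ball of radius [r]. *)
have intE s : `|s| = r -> q t = q s -> False.
  move=> sr qts; have /qE : q (s - t) = 0 by rewrite chomB qts subrr.
  move=> /intrP[m mE].
  have : `|s - t| < 1 by apply: (le_lt_trans (ler_normB _ _)); rewrite sr; lra.
  rewrite mE -intr_norm -[1]/(1%:~R) ltr_int => m1.
  have m0 : m = 0 by apply/eqP; rewrite -normr_eq0; lia.
  move: mE; rewrite m0 => /eqP; rewrite subr_eq0 => /eqP st.
  by rewrite -st sr ltxx in tr.
case: (sgn N) => E; rewrite E in qt.
  by apply: (intE r) => //; rewrite gtr0_norm.
by apply: (intE (- r)); rewrite ?chomN// normrN gtr0_norm.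
Qed.

Lemma ptws_chom_surj (n : nat) (A : topologicalZmodType) :
  exists q : chom {ptws 'I_n.+1 -> A} A, forall a, exists f, q f = a.
Proof.
have [q qE] := @ptws_proj 'I_n.+1 A ord0.
by exists q => a; exists (fun=> a); rewrite qE.
Qed.

(** A positive [n] or [d] would make the line or the circle a continuous image of [L], hence
    topologically p-torsion. So only the discrete summand remains. *)
Lemma lie_p_torsion_like_discrete (L : topologicalZmodType) :
  abelian_polish_lie R L -> p_torsion_like L -> nbhs 0 [set (0 : L)].
Proof.
move=> [_ [n [d [D [_ [f [g [fg gf]]]]]]]] pL.
have pM := p_torsion_like_image (f := f) (fun b => ex_intro _ (g b) (gf b)) pL.
have [q1 q1E] := @tdsum_fst (tdsum {ptws 'I_n -> R} {ptws 'I_d -> circle R})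
  (discrete_topology D).
have [q2 q2E] := @tdsum_fst {ptws 'I_n -> R} {ptws 'I_d -> circle R}.
have [q3 q3E] := @tdsum_snd {ptws 'I_n -> R} {ptws 'I_d -> circle R}.
have [q4 q4E] := @tdsum_snd (tdsum {ptws 'I_n -> R} {ptws 'I_d -> circle R})
  (discrete_topology D).
have pM1 := p_torsion_like_image (f := q1)
  (fun b => ex_intro _ (b, 0) (q1E _)) pM.
have pM2 := p_torsion_like_image (f := q2)
  (fun b => ex_intro _ (b, 0) (q2E _)) pM1.
have pM3 := p_torsion_like_image (f := q3)
  (fun b => ex_intro _ (0, b) (q3E _)) pM1.
have n0 : n = 0%N.
  case: n {f g fg gf pM q1 q1E q2 q2E q3 q3E q4 q4E pM1 pM3} pM2 => // n pn.
  have [q qs] := @ptws_chom_surj n R.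
  by case: real_not_p_torsion_like; exact: p_torsion_like_image qs pn.
have d0 : d = 0%N.
  case: d {f g fg gf pM q1 q1E q2 q2E q3 q3E q4 q4E pM1 pM2} pM3 => // d pd.
  have [q qs] := @ptws_chom_surj d (circle R).
  by case: circle_not_p_torsion_like; exact: p_torsion_like_image qs pd.
have [h hE] := chom_comp q4 f.
have := chom_nbhs0 h (discrete_set1 (0 : discrete_topology D)).
apply: filterS => x /=; rewrite hE q4E => x0.
rewrite -(fg x) -(chom0 g); congr (g _).
have {x0} : (f x).2 = 0 by [].
case: (f x) => [[a b] c] /= ->; congr (_, _, _).
  by apply/funext => -[i i0]; exfalso; rewrite n0 in i0.
by apply/funext => -[i i0]; exfalso; rewrite d0 in i0.
Qed.

End LieDiscrete.

Section ProP.
Context (R : realType) (p : nat) (p_prime : prime p) (G : topologicalZmodType).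

(** The working form of the pro-p condition: for prime [p] and a Polish group the two agree, by
    [pro_p_of_linear] and [pro_p_linear]. *)
Definition p_linear : Prop := forall U : set G, nbhs 0 U ->
  exists N : set G, [/\ subgroup N, nbhs 0 N, N `<=` U &
    forall x, exists n, N (x *+ (p ^ n))].

Lemma p_linear_torsion_like : p_linear -> p_torsion_like p G.
Proof.
move=> pG x U /pG[N [sN nN NU tN]]; have [n xn] := tN x.
exists n => // m /= nm; apply: NU.
by rewrite -(subnK nm) addnC expnD mulrnA; exact: subgroupMn.
Qed.

Lemma countable_cosets (N : set G) : polish R G -> nbhs 0 N -> subgroup N ->
  exists e : nat -> G, forall x, exists j, N (x - e j).
Proof.
move=> /dense_enum[q qP] nN sN; exists q => x.
apply: (qP x [set y | N (x - y)]); apply/nbhs0_translate.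
by apply: filterS nN => t Nt /=; rewrite opprD addrA subrr sub0r;
  exact: subgroupN.
Qed.

Lemma open_lie_cokernel (N : zmodClosed G) :
    polish R G -> nbhs 0 [set` N] -> (forall x, exists n, x *+ (p ^ n) \in N) ->
  lie_cokernel R N /\ topological_pgroup R p (tquot N).
Proof.
move=> pG nN tN; have [f [fs fE fo]] := tproj_exists N.
have sN := subgroup_zmodClosed N.
have dQ : nbhs (0 : tquot N) [set 0].
  by apply: filterS (fo _ nN) => _ [x /fE -> <-].
have cQ : countable [set: tquot N].
  have [e eP] := countable_cosets pG nN sN.
  have -> : [set: tquot N] = [set f (e j) | j in [set: nat]].
    apply/seteqP; split=> // u _; have [x <-] := fs u.
    have [j /= xj] := eP x; exists j => //; apply/eqP.
    by rewrite eq_sym -subr_eq0 -chomB; apply/eqP/fE.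
  exact: sub_countable (card_image_le _ _) (countableP _).
split.
  split; last exact: discrete_lie.
  move=> x xN; have [|y [/= yN]] := xN [set y | y - x \in N].
    by apply/nbhs0_translate; apply: filterS nN => t /= tN';
      rewrite addrC addKr.
  by move=> /(rpredB yN); rewrite opprB addrC subrK.
apply: discrete_pgroup => // u; have [x <-] := fs u; have [n xn] := tN x.
by exists n; rewrite -chomMn; apply/fE.
Qed.

(** For an arbitrary Lie quotient [G / M], topological p-torsion passes from [G] to [G / M], which
    is therefore discrete. So [M] is open and contains a basic open subgroup. *)
Lemma pro_p_of_linear : polish R G -> p_linear -> pro_p R p G.
Proof.
move=> pG lG.
have H (U : set G) : nbhs 0 U -> exists N : zmodClosed G,
    [/\ lie_cokernel R N, [set` N] `<=` U & topological_pgroup R p (tquot N)].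
  move=> /lG[K [sK nK KU tK]]; have [N NK] := zmodClosed_of_subgroup sK.
  have [||lN tN] := @open_lie_cokernel N pG.
  - by rewrite NK.
  - by move=> x; have [n xn] := tK x; exists n;
    have : [set` N] (x *+ (p ^ n)) by rewrite NK.
  by exists N; split=> //; rewrite NK.
split; first by split=> // U /H[N [lN NU _]]; exists N.
move=> M [cM lM]; apply: H.
have [f [fs fE fo]] := tproj_exists M.
have /(lie_p_torsion_like_discrete p_prime lM) dM : p_torsion_like p (tquot M).
  exact: p_torsion_like_image fs (p_linear_torsion_like lG).
by apply: filterS (chom_nbhs0 f dM) => x /= /fE.
Qed.

(** The subgroups [N] provided by the definition have quotients that are both Lie and topological
    p-groups, hence discrete; so [N] is open, and convergence to 0 in the quotient means being
    eventually 0. *)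
Lemma pro_p_linear : pro_p R p G -> polish R G /\ p_linear.
Proof.
move=> [[pG lG] pN]; split=> // U /lG[M lM MU].
have [N [lN NM [_ _ tN]]] := pN _ lM.
have [f [fs fE fo]] := tproj_exists N.
have dN : nbhs (0 : tquot N) [set 0].
  exact: (lie_p_torsion_like_discrete p_prime lN.2 tN).
exists [set` N]; split; first exact: subgroup_zmodClosed.
- by apply: filterS (chom_nbhs0 f dN) => x /= /fE.
- by move=> x /NM/MU.
- move=> x; have [n _ nP] := tN (f x) _ dN.
  by exists n; apply/fE; rewrite chomMn; exact: (nP n (leqnn n)).
Qed.

End ProP.

(** * The resolution of a pro-p group *)

(** [P] is the property that the chosen subgroups must keep: p-torsion of the quotient for the
    resolution, divisibility for the product decomposition. *)
Lemma nbhs_filtration_exists (R : realType) (T : topologicalZmodType)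
    (d : T -> T -> R) (P : set T -> Prop) : metrizes d -> P setT ->
    (forall U : set T, nbhs 0 U ->
       exists K : set T, [/\ subgroup K, nbhs 0 K, K `<=` U & P K]) ->
  exists H : nat -> set T, nbhs_filtration H /\ forall n, P (H n).
Proof.
move=> td PT PU.
have /choice[K KP] : forall U : set T, exists K : set T,
    nbhs 0 U -> [/\ subgroup K, nbhs 0 K, K `<=` U & P K].
  move=> U; have [/PU[K ?]|?] := pselect (nbhs 0 U); first by exists K.
  by exists U.
pose B n := [set y | d (0 : T) y < n.+1%:R^-1].
have nB n : nbhs 0 (B n) by apply: nbhs_mball.
pose H := fix H n := if n is m.+1 then K (H m `&` B m) else setT.
have nH n : nbhs 0 (H n).
  elim: n => [|n IH]; first exact: filterT.
  by case: (KP _ (filterI IH (nB n))).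
have HS n : [/\ subgroup (H n.+1), nbhs 0 (H n.+1),
  H n.+1 `<=` H n `&` B n & P (H n.+1)].
  by apply: KP; exact: filterI.
exists H; split; last by case=> [//|n]; case: (HS n).
split=> //.
- split=> //.
  + by case=> [|n]; [split|case: (HS n)].
  + by move=> n; case: (HS n) => _ _ + _ => HB x /HB[].
- move=> U /(mball_nbhs td)[e e0 eU].
  have [n ne] := inv_succ_lt e0.
  exists n.+1 => x; case: (HS n) => _ _ + _ => HB /HB[_ /= Bx].
  by apply: eU => /=; exact: lt_trans ne.
Qed.

Lemma id_chom (A : topologicalZmodType) :
  exists i : chom A A, forall x, i x = x.
Proof.
have [|i0 i0E] := @zmod_morphism_additive A A id; first by [].
have [|i iE] := @chom_of_additive _ _ i0; first by rewrite i0E => x;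
  exact: cvg_id.
by exists i => x; rewrite iE i0E.
Qed.

Lemma homeo_onto_range_intro (A B : topologicalZmodType) (f : chom A B) :
    injective f ->
    (forall K : set A, nbhs 0 K ->
      exists2 V : set B, nbhs 0 V & forall a, V (f a) -> K a) ->
  homeo_onto_range f.
Proof.
move=> finj fK; split=> //; first exact: chom_continuous.
move=> W oW.
(* The largest open set whose trace on the range lies in the image of [W]. *)
exists (\bigcup_(V in [set V | open V /\ V `&` range f `<=` f @` W]) V).
  by apply: bigcup_open => V [].
apply/seteqP; split=> [_ [x Wx <-]|y [[V [_ VW] Vy] yf]]; last exact: VW.
split; last by exists x.
have /nbhs0_translate/fK[V nV VW] : nbhs x W by exact: open_nbhs_nbhs.
have nfx : nbhs (f x) [set y | V (y - f x)].
  by apply/nbhs0_translate; apply: filterS nV => t Vt /=; rewrite addrC addKr.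
exists [set y | V (y - f x)]°; last exact: nbhs_singleton (nbhs_interior nfx).
split; first exact: open_interior.
move=> y [Vy [x' _ fx]]; exists x' => //.
have /= {}Vy := nbhs_singleton Vy.
by rewrite -(subrK x x') addrC; apply: VW; rewrite chomB fx.
Qed.

Lemma chom_lift (A G B : topologicalZmodType) (f : chom G B) (h : chom A B) :
    homeo_onto_range f -> (forall x, exists y, f y = h x) ->
  exists k : chom A G, forall x, f (k x) = h x.
Proof.
move=> hf /choice[k kP]; have [finj _ _] := hf.
have [|k0 k0E] := @zmod_morphism_additive A G k.
  by move=> x y; apply: finj; rewrite chomB !kP chomB.
have [|k1 k1E] := @chom_of_additive _ _ k0.
  apply: additive_continuous => U /(homeo_nbhs0 hf)[V nV VU].
  by apply: filterS (chom_nbhs0 h nV) => x /= Vx; apply: VU; rewrite k0E kP.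
by exists k1 => x; rewrite k1E k0E.
Qed.

Lemma tiso_intro (A B : topologicalZmodType) (f : chom A B) :
    (forall x, f x = 0 -> x = 0) -> (forall y, exists x, f x = y) ->
    (forall U : set A, nbhs 0 U -> nbhs 0 (f @` U)) ->
  tiso A B.
Proof.
move=> f0 fs fo; have [i iE] := id_chom A.
have [|g gE] := chom_factor (h := i) fs fo.
  by move=> b /f0 ->; rewrite chom0.
exists f, g; split=> [x|y]; first by rewrite gE iE.
by have [x <-] := fs y; rewrite gE iE.
Qed.

Lemma filter_forall_lt (T : Type) (F : set_system T) (X : nat -> set T) n :
  Filter F -> (forall m, F (X m)) -> F [set u | forall m, (m < n)%N -> X m u].
Proof.
move=> FF FX; elim: n => [|n IH]; first by apply: filterS filterT.
apply: filterS (filterI IH (FX n)) => u [uX Xn] m.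
by rewrite ltnS leq_eqVlt => /orP[/eqP ->|/uX].
Qed.

Lemma upto_enum (T : pointedType) (X : set T) : countable X ->
  exists (alpha : option nat) (e : upto alpha -> T), injective e /\ range e = X.
Proof.
move=> cX; have [fX|iX] := pselect (finite_set X).
  have /finite_setP[n] := fX; rewrite card_eq_sym =>
    /card_set_bijP[f [f1 f2 f3]].
  exists (Some n), (fun i : 'I_n => f i); split.
    by move=> i j ij; apply: val_inj; apply: f2 ij; rewrite inE /=.
  apply/seteqP; split=> [_ [i _ <-]|x /f3[i /= ni <-]];
    first by apply: f1 => /=.
  by exists (Ordinal ni).
have := eq_card_nat cX iX; rewrite card_eq_sym => /card_set_bijP[f [f1 f2 f3]].
exists None, f; split; first by move=> i j; apply: f2; rewrite inE.
apply/seteqP; split=> [_ [i _ <-]|x /f3//]; exact: f1.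
Qed.

Definition even_shift_fun (A : zmodType) (f : nat -> A) i : A :=
  if odd i then 0 else f i./2.

Lemma even_shift (A : zmodType) : exists h :
  {additive omega_sum A -> omega_sum A},
  forall f i, h f i = even_shift_fun f i.
Proof.
have /choice[h hP] : forall f : omega_sum A, exists g : omega_sum A,
    forall i, g i = even_shift_fun f i.
  move=> f; have [n fn] := omega_sum_bound f.
  apply: (@omega_sum_intro A (even_shift_fun f) n.*2) => i ni.
  by rewrite /even_shift_fun fn ?if_same//; lia.
have [|k kE] := @zmod_morphism_additive (omega_sum A) (omega_sum A) h.
  move=> f g; apply: omega_sum_eq => i; rewrite omega_sumB !hP /even_shift_fun.
  by case: ifP; rewrite ?subr0.
by exists k => f i; rewrite kE hP.
Qed.

Lemma pigeonhole_seq (T : eqType) (L : seq T) (f : nat -> T) :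
  (forall k, f k \in L) -> exists i j, (i < j)%N /\ f i = f j.
Proof.
move=> fL; apply: contrapT => H.
have : uniq (map f (iota 0 (size L).+1)).
  rewrite map_inj_uniq ?iota_uniq// => i j fij.
  have [ij|ji|//] := ltngtP i j; exfalso; apply: H; first by exists i, j.
  by exists j, i.
have fsub : {subset [seq f i | i <- iota 0 (size L).+1] <= L}.
  by move=> _ /mapP[k _ ->].
by move=> /uniq_leq_size /(_ fsub); rewrite size_map size_iota ltnn.
Qed.

Section Resolution.
Context (R : realType) (p : nat) (p_prime : prime p).

Local Notation A := {ptws nat -> discrete_topology (omega_sum (prufer p))}.

Lemma omega_sum_prufer_countable : countable [set: omega_sum (prufer p)].
Proof. exact/omega_sum_countable/prufer_countable. Qed.

Lemma omega_sum_prufer_divisible : divisible [set: omega_sum (prufer p)].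
Proof. exact/omega_sum_divisible/prufer_divisible. Qed.

Lemma polish_omega_power : polish R A.
Proof. exact/polish_discrete_power/omega_sum_prufer_countable. Qed.

Lemma p_linear_omega_power : p_linear p A.
Proof.
move=> U nU; have [[_ sH _] nH HP] :=
  tail_nbhs_filtration (omega_sum (prufer p)).
have [n nU'] := HP _ nU; exists (tail n); split=> //.
by move=> x; apply: tail_torsion => f; exact: omega_sum_prufer_torsion.
Qed.

Lemma pro_p_omega_power : pro_p R p A.
Proof. by apply: pro_p_of_linear => //;
  [exact: polish_omega_power|exact: p_linear_omega_power]. Qed.

Lemma linear_injective_omega_power : linear_injective A.
Proof. exact/linear_injective_ptws/linear_injective_discrete/omega_sum_prufer_divisible. Qed.

(* The coordinates of [iota] live in the even summands, so that the odd ones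
   make every layer of [A / range iota] a divisible group of infinite rank. *)
Theorem pro_p_resolution (G : topologicalZmodType) : pro_p R p G ->
  exists (iota : chom G A) (phi : chom A A), tses iota phi.
Proof.
move=> /(pro_p_linear p_prime)[pG lG]; have [_ [d [md td cd]]] := pG.
have [|U nU|H [nH tH]] := @nbhs_filtration_exists R G d
  (fun K => forall x, exists n, K (x *+ (p ^ n))) td.
- by move=> x; exists 0%N.
- exact: lG.
have [fH nHn HP] := nH; have [H0 sH HS] := fH.
have sepH := nbhs_filtration_separated md td nH.
have cH := nbhs_filtration_complete md td cd nH.
have [h hE] := even_shift (prufer p).
(* [socle_basis] with the whole group as [K] embeds the countable p-group [G / H n] into the direct
   sum. *)
have /choice[r rP] : forall n, exists r :
  chom G (discrete_topology (omega_sum (prufer p))),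
    (forall x, r x = 0 <-> H n x) /\
      (forall x i, odd i -> (r x : omega_sum _) i = 0).
  move=> n; have [e eP] := countable_cosets pG (nHn n) (sH n).
  have [|||S [rho [r1 r2 _ _ _]]] :=
    @socle_basis p p_prime G (H n) setT (sH n) _ _ e eP.
  - by [].
  - by [].
  - by move=> x _; exact: tH.
  have hK x : h (rho x) = 0 <-> H n x.
    split=> [h0|/r1->]; last by rewrite raddf0.
    apply: r2 => //; apply: omega_sum_eq => i.
    by have := hE (rho x) i.*2;
      rewrite h0 /even_shift_fun odd_double doubleK => <-.
  pose q : {additive G -> discrete_topology (omega_sum (prufer p))} := h \o rho.
  have [|r rE] := @chom_of_additive _ _ q.
    by apply: (additive_cst_continuous (nHn n)) => x /hK.
  exists r; split=> [x|x i oi]; first by rewrite rE; exact: hK.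
  by rewrite rE /q /= hE /even_shift_fun oi.
have [iota iotaE] := ptws_chom r.
have iota_tail n x : tail n (iota x) <-> forall i, (i < n)%N -> H i x.
  split=> ix i ni; first by apply/(rP i).1; rewrite -iotaE; exact: ix.
  by rewrite iotaE; apply/(rP i).1; exact: ix.
(* The shift by one: [tail n.+1] constrains the coordinates 0 to [n], whose kernels decrease to
   [H n]. *)
have iota_tailS n x : tail n.+1 (iota x) <-> H n x.
  split=> [/iota_tail|Hx]; first exact.
  by apply/iota_tail => i; rewrite ltnS => /(filtration_le fH); exact.
have [_ nT TP] := tail_nbhs_filtration (omega_sum (prufer p)).
have iota_inj : injective iota.
  move=> x y xy; apply/eqP; rewrite -subr_eq0; apply/eqP/sepH => n.
  by apply/iota_tailS; rewrite chomB xy subrr;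
    exact: subgroup0 (tail_subgroup _ _).
have iota_homeo : homeo_onto_range iota.
  apply: homeo_onto_range_intro => // K /HP[n HK].
  by exists (tail n.+1) => // a /iota_tailS/HK.
have sI : subgroup (range iota).
  split; first by exists 0 => //; exact: chom0.
  by move=> _ _ [x _ <-] [y _ <-]; exists (x - y) => //; exact: chomB.
(* Approximations of [y] by elements of the range come from a sequence that is Cauchy for [H],
   because [iota] reflects the filtrations; completeness of [G] gives the preimage of [y]. *)
have closed_iota y : (forall n, sumset (range iota) (tail n) y) -> range iota y.
  move=> yn.
  have /choice[g gP] : forall n, exists g, tail n (y - iota g).
    by move=> n; have [_ [g _ <-] ?] := yn n; exists g.
  have [n|l lP] := cH (fun n => g n.+1).
    apply/iota_tailS; rewrite chomB -(subrKA y).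
    apply: subgroupD (tail_subgroup _ _) _ _; last first.
      by move=> i ni; apply: (gP n.+1).
    apply: subgroup_subC (tail_subgroup _ _) _.
    by move=> i ni; apply: (gP n.+2); exact: leqW.
  exists l => //; apply/eqP; rewrite eq_sym -subr_eq0; apply/eqP.
  apply: tail_separated => -[|n]; first by [].
  rewrite -(subrKA (iota (g n.+1))); apply: subgroupD (tail_subgroup _ _) _ _.
    exact: gP.
  by apply: subgroup_subC (tail_subgroup _ _) _; rewrite -chomB;
    apply/iota_tailS.
have countD := omega_sum_prufer_countable.
have [fT _ _] := tail_nbhs_filtration (omega_sum (prufer p)).
have torsT n (x : A) : exists k, tail n (x *+ (p ^ k)).
  by apply: tail_torsion => f; exact: omega_sum_prufer_torsion.
have divT n (x : A) : tail n x -> exists2 y, tail n y & y *+ p = x.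
  by apply: (tail_divisible omega_sum_prufer_divisible); exact: prime_gt0.
have [S [rho [rK rG rS rf rfin]]] := filtration_coordinates p_prime fT
  (@tail_complete _) sI (tail_countable countD) torsT divT closed_iota.
(* A layer of finite rank would have a finite socle. But the elements with the socle generator [c]
   at the odd place [k.*2.+1] of coordinate [n] are pairwise incongruent, since the range of [iota]
   vanishes at odd places. *)
have ST n : S n = setT.
  case: (rfin n) => // -[_ [L LP]]; exfalso.
  have [c [c0 cp _]] := prufer_socle p_prime.
  have /choice[del delE] : forall k, exists f : omega_sum (prufer p),
      forall i, f i = if i == k.*2.+1 then c else 0.
    move=> k; apply: (@omega_sum_intro _ (fun i =>
      if i == k.*2.+1 then c else 0) k.*2.+2).
    by move=> i ki; rewrite gtn_eqF.
  pose e k : A := fun i => if i == n then del k else 0.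
  have /choice[a aP] : forall k, exists a, a \in L /\
    sumset (range iota) (tail n.+1) (e k - a).
    move=> k; have [|| a aL ea] := LP (e k); last by exists a.
      apply: subset_sumsetr => // i ni; rewrite /e ltn_eqF//.
    have -> : e k *+ p = 0.
      apply/funext => i.
      rewrite discrete_powerMn /e; case: eqP => _; last by rewrite mul0rn.
      by apply: omega_sum_eq => j; rewrite omega_sumMn delE; case: eqP;
        rewrite ?cp ?mul0rn.
    exact: subgroup0 (sumset_subgroup sI (tail_subgroup _ _)).
  have [i [j [ij aij]]] := pigeonhole_seq (fun k => (aP k).1).
  have [_ [g _ <-]] : sumset (range iota) (tail n.+1) (e i - e j).
    rewrite -(subrKA (a i)); apply:
      (subgroupD (sumset_subgroup sI (tail_subgroup _ _))).
      exact: (aP i).2.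
    apply: (subgroup_subC (sumset_subgroup sI (tail_subgroup _ _))).
    by rewrite aij; exact: (aP j).2.
  move=> /(_ n (ltnSn n)) /eqP.
  rewrite -[X in X == _]/((e i n - e j n) - iota g n) subr_eq0 => /eqP.
  move=> /(congr1 (fun f : omega_sum (prufer p) => f i.*2.+1)).
  rewrite iotaE (rP n).2 /=; last by rewrite odd_double.
  rewrite /e eqxx => eij; have {eij} : del i i.*2.+1 - del j i.*2.+1 = 0 by [].
  rewrite !delE eqxx ifF ?subr0; last first.
    by apply/eqP => /eqP; rewrite eqSS -!muln2 eqn_pmul2r// ltn_eqF.
  by move/eqP; rewrite (negbTE c0).
have /choice[q qP] : forall n, exists q :
  chom A (discrete_topology (omega_sum (prufer p))),
    forall x, q x = rho n x.
  move=> n; have [|q qE] := @chom_of_additive A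
    (discrete_topology (omega_sum (prufer p))) (rho n).
    apply: (additive_cst_continuous (nT n.+1)) => x nx.
    by apply: (rK n.+1 x).1 => //; exact: subset_sumsetr.
  by exists q.
have [phi phiE] := ptws_chom q.
have phi0 x : phi x = 0 <-> range iota x.
  split=> [x0|/rG xi]; last by apply/funext => n; rewrite phiE qP xi.
  by apply/rG => n; rewrite -qP -phiE x0.
exists iota, phi; split=> //.
- split=> //; first by apply/seteqP; split=> x /= /phi0.
  apply/seteqP; split=> // f _.
  have [|x xE] := rf f; first by move=> n i; rewrite ST => /(_ I).
  by exists x => //; apply/funext => n; rewrite phiE qP xE.
- move=> y yc; apply: closed_iota => n.
  have [|z [/= zi Tz]] := yc [set z | tail n (z - y)].
    by apply/nbhs0_translate; apply: filterS (nT n) => t /= Tt;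
      rewrite addrC addKr.
  by exists z => //; exact: subgroup_subC (tail_subgroup _ _) _.
Qed.

End Resolution.

(** * The equivalences *)

Section Implications.
Context (R : realType) (p : nat) (p_prime : prime p) (G : topologicalZmodType).
Hypothesis ppG : pro_p R p G.

Local Notation A := {ptws nat -> discrete_topology (omega_sum (prufer p))}.
Local Notation product_form := (exists alpha beta : option nat,
  tiso G (tdsum {ptws (upto alpha) -> discrete_topology (prufer p)}
                {ptws (upto beta) ->
                  discrete_topology (omega_sum (prufer p))})).

(** Divisibility passes to images. The images of the tails under [ret] are open because each
    contains the preimage of the tail under [iota]. *)
Lemma retract_divisible (iota : chom G A) (ret : chom A G) :
    homeo_onto_range iota -> cancel iota ret ->
  divisible [set: G] /\ divisible_basis0 G.
Proof.
move=> hi retK; have [_ nT TP] := tail_nbhs_filtration (omega_sum (prufer p)).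
have divT := tail_divisible (omega_sum_prufer_divisible p_prime).
split.
  move=> n x n0 _; have t0 : tail 0 (iota x) by [].
  have [y _ yx] := divT 0%N n (iota x) n0 t0.
  by exists (ret y) => //; rewrite -chomMn yx retK.
move=> U nU; have [n nRU] := TP _ (chom_nbhs0 ret nU).
have sH : subgroup (ret @` tail n).
  split; first by exists 0 => //; exact: chom0.
  move=> _ _ [x nx <-] [y ny <-]; exists (x - y); last exact: chomB.
  exact: subgroupB (tail_subgroup _ _) _ _.
have [H HE] := zmodClosed_of_subgroup sH; exists H; rewrite HE; split.
- apply: filterS (chom_nbhs0 iota (nT n)) => x nx.
  by exists (iota x) => //; exact: retK.
- by move=> _ [x /nRU Ux <-].
- move=> k _ k0 [x nx <-]; have [y ny yx] := divT n k x k0 nx.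
  by exists (ret y); [exists y|rewrite -chomMn yx].
Qed.

(** The retraction is an extension of the identity of [G] along [iota]. *)
Lemma injective_retract (iota : chom G A) (phi : chom A A) :
    tses iota phi -> injective_PAb R p G ->
  exists ret : chom A G, cancel iota ret.
Proof.
move=> es [_ /(_ _ _ _ _ _ ppG (pro_p_omega_power R p_prime)
  (pro_p_omega_power R p_prime) es)].
move=> [_ _ surj]; have [i iE] := id_chom G.
have [ret _ retE] : range (precomp G iota) i by rewrite surj.
by exists ret => x; rewrite -[LHS]/(precomp G iota ret x) retE iE.
Qed.

(** The endomorphism [i - q], the identity minus [s] after [phi], takes its values in the kernel of
    [phi], which is the range of [iota]; lifting it through [iota] gives the retraction. *)
Lemma split_retract (iota : chom G A) (phi s : chom A A) :
  tses iota phi -> cancel s phi -> exists ret : chom A G, cancel iota ret.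
Proof.
move=> [[iinj iphi _] hi _] sK; have [i iE] := id_chom A;
  have [q qE] := chom_comp s phi.
have [|ret retE] := chom_lift (h := i - q) hi.
  move=> x; have [y _ yE] : range iota ((i - q) x); last by exists y.
  rewrite iphi; suff : phi ((i - q) x) = 0 by [].
  by rewrite chom_subE iE qE chomB sK subrr.
exists ret => x; apply: iinj; rewrite retE chom_subE iE qE.
have -> : phi (iota x) = 0.
  have : range iota (iota x) by exists x.
  by rewrite iphi.
by rewrite chom0 subr0.
Qed.

Lemma linear_topology_of_p_linear (T : topologicalZmodType) : p_linear p T ->
  linear_topology T.
Proof. by move=> lT U /lT[K [? ? ? _]]; exists K. Qed.

(** Polishness of the middle and right terms makes [g] open, so a homomorphism that kills the range
    of [f] descends along [g]. Surjectivity of restriction along [f] is linear injectivity. *)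
Lemma linear_injective_PAb : linear_injective G -> injective_PAb R p G.
Proof.
move=> iG; split=> // X Y Z f g ppX ppY ppZ [[finj fg gs] hf _].
have [pY lY] := pro_p_linear p_prime ppY;
  have [pZ _] := pro_p_linear p_prime ppZ.
have gs' c : exists b, g b = c.
  have [b _ <-] : range g c by rewrite gs.
  by exists b.
have go := open_mapping pY pZ gs'.
have gf x : g (f x) = 0.
  have : range f (f x) by exists x.
  by rewrite fg.
split.
- move=> h1 h2 h12; apply: val_inj; apply/funext => z /=; have [y <-] := gs' z.
  by rewrite -[LHS]/(precomp G g h1 y) h12.
- apply/seteqP; split=> [_ [h _ <-]|h /= hf0].
    by apply: val_inj; apply/funext => x /=; rewrite gf chom0.
  have [|k kE] := chom_factor (h := h) gs' go.
    move=> y gy; have [x _ <-] : range f y by rewrite fg.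
    by rewrite -[LHS]/(precomp G f h x) hf0.
  by exists k => //; apply: val_inj; apply/funext => y /=; rewrite kE.
- apply/seteqP; split=> // h _.
  have [k kE] := iG _ _ _ (linear_topology_of_p_linear lY) hf h.
  by exists k => //; apply: val_inj; apply/funext => x /=; rewrite kE.
Qed.

Lemma product_form_linear_injective : product_form -> linear_injective G.
Proof.
move=> [alpha [beta [f [g [fK _]]]]]; apply: (linear_injective_retract fK).
apply: linear_injective_tdsum; apply: linear_injective_ptws;
  apply: linear_injective_discrete.
  exact: prufer_divisible.
exact: omega_sum_prufer_divisible.
Qed.

(** The identity of [G] extends to [ret] on [X]; the identity of [X] minus [f] after [ret] kills the
    range of [f] and descends to a section of [g]. *)
Lemma linear_injective_Ext_eq0 : linear_injective G -> Ext_eq0 R A G.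
Proof.
move=> iG X f g pX [[finj fg gs] hf _].
have gs' c : exists b, g b = c.
  have [b _ <-] : range g c by rewrite gs.
  by exists b.
have go := open_mapping pX (polish_omega_power R p) gs'.
have gf x : g (f x) = 0.
  have : range f (f x) by exists x.
  by rewrite fg.
have [_ lG] := pro_p_linear p_prime ppG.
have lX : linear_topology X.
  apply: (linear_topology_extension hf _ gf go).
  - move=> x gx; have [y _ <-] : range f x by rewrite fg.
    by exists y.
  - exact: linear_topology_of_p_linear lG.
  - exact: linear_topology_of_p_linear (@p_linear_omega_power p).
have [i iE] := id_chom G; have [j jE] := id_chom X.
have [ret retE] := iG _ _ _ lX hf i.
have [q qE] := chom_comp f ret.
have [|s sE] := chom_factor (h := j - q) gs' go.
  move=> x gx; have [y _ <-] : range f x by rewrite fg.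
  by rewrite chom_subE jE qE retE iE subrr.
exists s => a; have [x <-] := gs' a.
by rewrite sE chom_subE jE qE chomB gf subr0.
Qed.

Lemma divisible_product_form :
  divisible [set: G] /\ divisible_basis0 G -> product_form.
Proof.
move=> [divG divB]; have [pG lG] := pro_p_linear p_prime ppG.
have [_ [d [md td cd]]] := pG.
have [|U nU|H [nH dH]] := @nbhs_filtration_exists R G d (fun K => divisible K)
  td.
- exact: divG.
- have [N [nN NU dN]] := divB U nU; exists [set` N]; split=> //.
  exact: subgroup_zmodClosed.
have [fH nHn HP] := nH; have [H0 sH HS] := fH.
have sepH := nbhs_filtration_separated md td nH.
have cH := nbhs_filtration_complete md td cd nH.
have s0 : subgroup [set (0 : G)] by split=> // x y -> ->; rewrite /= subrr.
have torsH n x : exists k, H n (x *+ (p ^ k)).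
  have [N [sN _ NH tN]] := lG _ (nHn n); have [k Nk] := tN x.
  by exists k; exact: NH.
have divH n x : H n x -> exists2 y, H n y & y *+ p = x.
  by apply: dH; exact: prime_gt0.
have H0E n x : sumset [set 0] (H n) x <-> H n x.
  by split=> [[_ ->]|Hx]; [rewrite subr0|exists 0; rewrite ?subr0].
(* Taking the subgroup 0 makes these the coordinates of [G] itself. *)
have [x nx|S [rho [rK rG rS rf rfin]]] :=
  filtration_coordinates p_prime fH cH s0
  (fun n => countable_cosets pG (nHn n) (sH n)) torsH divH.
  by apply: sepH => n; apply/H0E.
have rH n x : H n x <-> forall i, (i < n)%N -> rho i x = 0 by rewrite -H0E.
(* [F] lists the single coordinates of the layers of finite rank, [B] the layers of infinite rank;
   their cardinalities are the two exponents. *)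
pose F := [set u : nat * nat | finite_set (S u.1) /\ S u.1 u.2].
pose B := [set n | S n = setT].
have [alpha [eF [eFinj eFr]]] := upto_enum (countableP F).
have [beta [eB [eBinj eBr]]] := upto_enum (countableP B).
have rho_cont n : continuous (rho n : G ->
  discrete_topology (omega_sum (prufer p))).
  apply: (@additive_cst_continuous _ (discrete_topology (omega_sum (prufer p)))
    (rho n) (H n.+1)) => //.
  by move=> x /rH; apply.
have /choice[u uE] : forall j, exists q : chom G (discrete_topology (prufer p)),
    forall x, q x = rho (eF j).1 x (eF j).2.
  move=> j.
  have [|q0 q0E] := @zmod_morphism_additive G (discrete_topology (prufer p))
    (fun x => rho (eF j).1 x (eF j).2).
    by move=> x y; rewrite raddfB.
  have [|q qE] := @chom_of_additive _ _ q0.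
    apply: (additive_cst_continuous (nHn (eF j).1.+1)) => x /rH r0.
    by rewrite q0E r0.
  by exists q => x; rewrite qE q0E.
have /choice[v vE] : forall j, exists q :
  chom G (discrete_topology (omega_sum (prufer p))),
    forall x, q x = rho (eB j) x.
  move=> j; have [|q qE] := @chom_of_additive G
    (discrete_topology (omega_sum (prufer p))) (rho (eB j)).
    exact: rho_cont.
  by exists q.
have [U UE] := ptws_chom u; have [V VE] := ptws_chom v.
have [Psi PsiE] := tdsum_pair U V.
have rho0 n (x : G) : (forall j, (eF j).1 = n -> U x j = 0) ->
  (forall j, eB j = n -> V x j = 0) ->
    rho n x = 0.
  move=> U0 V0; have [Sn|[Sn _]] := rfin n.
    have [j _ jn] : range eB n by rewrite eBr.
    by have := V0 j jn; rewrite VE vE jn.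
  apply: omega_sum_eq => i; have [Si|/rS//] := pselect (S n i).
  have [j _ jn] : range eF (n, i) by rewrite eFr.
  by have := U0 j; rewrite jn UE uE jn; apply.
(* In each layer a target [f n] is assembled: an entry of the second power if the rank is infinite,
   otherwise entries of the first power, finitely many because [S n] is finite. Then [rf] realises
   all targets at once. *)
have Psi_surj z : exists x, Psi x = z.
  case: z => [a b].
  have /choice[f fP] : forall n, exists f : omega_sum (prufer p),
      [/\ forall i, ~ S n i -> f i = 0, forall j, (eF j).1 = n ->
        f (eF j).2 = a j &
          forall j, eB j = n -> f = b j].
    move=> n; have [Sn|[Sn _]] := rfin n.
      have [j _ jn] : range eB n by rewrite eBr.
      exists (b j); split=> [i|k kn|k kn].
      + by rewrite Sn => /(_ I).
      + have : F (eF k) by rewrite -eFr; exists k.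
        by rewrite /F/= kn Sn => -[/infinite_nat].
      + by congr (b _); apply: eBinj; rewrite jn kn.
    have /choice[g gP] : forall i, exists y : prufer p,
        (~ S n i -> y = 0) /\ (forall j, eF j = (n, i) -> y = a j).
      move=> i; have [[j jE]|nj] := pselect (exists j, eF j = (n, i)).
        exists (a j); split=> [nSi|k kE]; last by congr (a _); apply: eFinj;
          rewrite jE kE.
        have : F (eF j) by rewrite -eFr; exists j.
        by rewrite jE => -[].
      by exists 0; split=> // j jE; exfalso; apply: nj; exists j.
    have [m mP] : exists m, forall i, (m <= i)%N -> g i = 0.
      have /finite_seqP[L LE] := Sn.
      exists (\max_(i <- L) i).+1 => i Li; apply: (gP i).1; rewrite LE => /= iL.
      by have := @leq_bigmax_seq _ _ xpredT id i iL isT; rewrite leqNgt Li.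
    have [f fE] := omega_sum_intro mP; exists f; split=> [i nSi|j jn|j jn].
    + by rewrite fE; exact: (gP i).1.
    + by rewrite fE; apply: (gP _).2; rewrite -jn; case: (eF j).
    + have : B (eB j) by rewrite -eBr; exists j.
      by rewrite /B/= jn => SnT; rewrite SnT in Sn; case: (infinite_nat Sn).
  have [|x xE] := rf f; first by move=> n i; case: (fP n) => + _ _; apply.
  exists x; rewrite PsiE; congr (_, _); apply/funext => j.
    by rewrite UE uE xE; case: (fP (eF j).1) => _ + _; apply.
  by rewrite VE vE xE; case: (fP (eB j)) => _ _; apply.
exists alpha, beta; apply: (tiso_intro (f := Psi)) => //.
- move=> x; rewrite PsiE => -[Ux Vx].
  by apply/(rG x) => n; apply: rho0 => j _; rewrite ?Ux ?Vx.
- move=> W /HP[n HW].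
  have [q1 q1E] := @tdsum_fst {ptws (upto alpha) ->
    discrete_topology (prufer p)}
    {ptws (upto beta) -> discrete_topology (omega_sum (prufer p))}.
  have [q2 q2E] := @tdsum_snd {ptws (upto alpha) ->
    discrete_topology (prufer p)}
    {ptws (upto beta) -> discrete_topology (omega_sum (prufer p))}.
  (* Neighbourhoods of 0 in a power constrain only finitely many factors. The bound [b m] shows that
     the finite-rank layers below [n] impose finitely many conditions. *)
  have /choice[b bP] : forall m, exists b, finite_set (S m) ->
    forall i, S m i -> (i < b)%N.
    move=> m; have [/finite_seqP[L LE]|nf] := pselect (finite_set (S m));
      last by exists 0%N.
    exists (\max_(i <- L) i).+1 => _ i; rewrite LE => /= iL.
    by rewrite ltnS; exact: (@leq_bigmax_seq _ _ xpredT id i iL isT).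
  have n1 : nbhs 0 [set a : {ptws (upto alpha) ->
    discrete_topology (prufer p)} |
      forall m, (m < n)%N -> forall i, (i < b m)%N -> forall j, eF j = (m, i) ->
        a j = 0].
    apply: filter_forall_lt => m; apply: filter_forall_lt => i.
    have [[j jE]|nj] := pselect (exists j, eF j = (m, i)); last first.
      by apply: filterS filterT => a _ j jE; exfalso; apply: nj; exists j.
    have := @ptws_proj_nbhs _ (discrete_topology (prufer p)) 0 j [set 0]
      (discrete_set1 _).
    apply: filterS => a /= aj k kE.
    by have -> : k = j by apply: eFinj; rewrite kE jE.
  have n2 : nbhs 0 [set a : {ptws (upto beta) ->
    discrete_topology (omega_sum (prufer p))} |
      forall m, (m < n)%N -> forall j, eB j = m -> a j = 0].
    apply: filter_forall_lt => m.
    have [[j jE]|nj] := pselect (exists j, eB j = m); last first.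
      by apply: filterS filterT => a _ j jE; exfalso; apply: nj; exists j.
    have := @ptws_proj_nbhs _ (discrete_topology (omega_sum (prufer p))) 0 j
      [set 0] (discrete_set1 _).
    apply: filterS => a /= aj k kE.
    by have -> : k = j by apply: eBinj; rewrite kE jE.
  apply: filterS (filterI (chom_nbhs0 q1 n1) (chom_nbhs0 q2 n2)) =>
    z [/= z1 z2].
  have [x xz] := Psi_surj z; exists x => //; apply: HW; apply/rH => m mn.
  move: z1 z2; rewrite q1E q2E -xz PsiE /= => z1 z2.
  apply: rho0 => j jm; last exact: z2 jm.
  have [fS Sj] : F (eF j) by rewrite -eFr; exists j.
  apply: (z1 m mn (eF j).2); last by rewrite -jm; case: (eF j).
  by rewrite -jm; exact: bP.
Qed.

End Implications.

Theorem theorem4p2 (R : realType) (p : nat) (p_prime : prime p)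
    (G : topologicalZmodType) (G_pro_p : pro_p R p G) :
  [<-> injective_PAb R p G;
       divisible [set: G] /\ divisible_basis0 G;
       exists alpha beta : option nat,
         tiso G (tdsum {ptws (upto alpha) -> discrete_topology (prufer p)}
                       {ptws (upto beta) ->
                          discrete_topology (omega_sum (prufer p))});
       Ext_eq0 R {ptws nat -> discrete_topology (omega_sum (prufer p))} G].
Proof.
have [iota [phi es]] := pro_p_resolution p_prime G_pro_p.
have [_ hi _] := es.
tfae.
- move=> /(injective_retract p_prime G_pro_p es)[ret retK].
  exact: (retract_divisible p_prime hi retK).
- exact: (divisible_product_form p_prime G_pro_p).
- by move=> /(product_form_linear_injective p_prime)/(linear_injective_Ext_eq0
  p_prime G_pro_p).
(* The resolution is itself an extension of the power by [G], so the Ext condition splits it. *)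
- move=> /(_ _ iota phi (polish_omega_power R p) es)[s sK].
  have [ret retK] := split_retract es sK.
  apply: (linear_injective_PAb p_prime G_pro_p).
  exact: linear_injective_retract retK (linear_injective_omega_power p_prime).
Qed.
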